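(* Fix $0<\alpha\le 1$. Let $\mathcal G_{k,\alpha}$ denote the Erdős–Rényi random graph on $k$ vertices with edge probability $\alpha$. Then, with probability tending to $1$ as $k\to\infty$, the limit $\ell(\mathcal G_{k,\alpha})$ exists and $$\ell(\mathcal G_{k,\alpha})=\frac{1}{\lambda(\mathcal G_{k,\alpha})}.$$
   Context: $H$-percolation: fix a graph $H$. Start with $\mathcal G_0=\mathcal G_{n,p}$ (Erdős–Rényi graph on $n$ vertices, edge probability $p$). For $t\ge 1$, obtain $\mathcal G_t$ from $\mathcal G_{t-1}$ by adding every edge $e\notin\mathcal G_{t-1}$ such that $\mathcal G_{t-1}\cup\{e\}$ contains a copy of $H$ containing $e$. Let $\langle \mathcal G_{n,p}\rangle_H=\bigcup_{t\ge0}\mathcal G_t$. The critical threshold is $p_c(n,H)=\inf\{p>0:\ \mathbb P(\langle\mathcal G_{n,p}\rangle_H=K_n)\ge 1/2\}$, and $\ell(H)=-\lim_{n\to\infty}\frac{\log p_c(n,H)}{\log n}$. For a graph $H$ with $v_H$ vertices and $e_H$ edges, $\lambda(H)=\frac{e_H-2}{v_H-2}$. *)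

(* Defs.v *)
From HB Require Import structures.
From mathcomp Require Import all_boot all_order all_algebra.
From mathcomp Require Import all_classical all_reals all_analysis.
Set Implicit Arguments. Unset Strict Implicit. Unset Printing Implicit Defensive.
Import Order.TTheory GRing.Theory Num.Theory numFieldNormedType.Exports.
Local Open Scope ring_scope.
Local Open Scope classical_set_scope.

(* A simple graph on a finite vertex type T is a set of edges, each edge a
   2-element subset of T. [pairs T] is the edge set of the complete graph. *)
Definition pairs (T : finType) : {set {set T}} := [set e : {set T} | #|e| == 2%N].

Definition gnp_prob (R : realType) (T : finType) (p : R)
  (P : {set {set T}} -> Prop) : R :=
  \sum_(E in powerset (pairs T) | `[< P E >])
     p ^+ #|E| * (1 - p) ^+ (#|pairs T| - #|E|).

Definition copy_containing (k n : nat) (EH : {set {set 'I_k}})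
  (G : {set {set 'I_n}}) (e : {set 'I_n}) : bool :=
  [exists f : {ffun 'I_k -> 'I_n},
     [&& injectiveb f, [forall h in EH, (f @: h) \in G]
       & [exists h in EH, f @: h == e]]].

Definition perc_step (k n : nat) (EH : {set {set 'I_k}})
  (G : {set {set 'I_n}}) : {set {set 'I_n}} :=
  G :|: [set e in pairs 'I_n | (e \notin G) && copy_containing EH (e |: G) e].

Definition percolates (k n : nat) (EH : {set {set 'I_k}})
  (G : {set {set 'I_n}}) : Prop :=
  forall e : {set 'I_n},
    (exists t : nat, e \in iter t (perc_step EH) G) <-> e \in pairs 'I_n.

Definition p_c (R : realType) (k : nat) (EH : {set {set 'I_k}}) (n : nat) : R :=
  inf [set p : R | 0 < p <= 1 /\ 2^-1 <= gnp_prob p (@percolates k n EH)].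

Definition lambda_H (R : realType) (k : nat) (EH : {set {set 'I_k}}) : R :=
  ((#|EH|%:R - 2) / (k%:R - 2)).

Definition ell_exists_eq (R : realType) (k : nat) (EH : {set {set 'I_k}}) (x : R)
  : Prop :=
  ((fun n : nat => - ln (p_c R EH n) / ln (n%:R : R)) : R^nat) @ \oo --> x.

(* Main.v *)
Require Import Defs.
From HB Require Import structures.
From mathcomp Require Import all_boot all_order all_algebra.
From mathcomp Require Import all_classical all_reals all_analysis.
From mathcomp Require Import ring lra zify.
Import Order.TTheory GRing.Theory Num.Theory numFieldNormedType.Exports.
(* [all_classical] shadows the finite-set names [set0], [subsetP], ... *)
Import mathcomp.boot.fintype mathcomp.boot.finset.
Set Implicit Arguments. Unset Strict Implicit. Unset Printing Implicit Defensive.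
Local Open Scope ring_scope.

(** Write e and v for the numbers of edges and vertices of H, and
    lambda = (e - 2)/(v - 2).  By Chernoff bounds, with high probability H is
    well balanced: e_S + 1 <= lambda (|S| - 2) for all vertex sets S with
    3 <= |S| < v, and H has two disjoint edges.  For such H the exponent is
    1/lambda.

    Lower bound on p_c.  Put fractional weights on the edges of G, as large as
    possible subject to w(X) <= lambda (|X| - 2) + 1 for every small vertex set
    X, and call X tight when equality holds.  Tight sets sharing two vertices
    have a tight union, every edge of G lies in a tight set, and balancedness
    of H makes the family of pairs covered by tight sets closed under the
    H-process, as long as no set of intermediate size has lambda (|X| - 2) + 1
    edges.  So if G percolates, either a set of bounded, large size or a bounded
    set around a prescribed pair is this dense, and for
    p = n^(-1/lambda - eps) a first moment computation excludes both.

    Upper bound on p_c.  Chain L copies of H together, an edge f1 of each copy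
    being removed and identified with the removed edge f0 of the next one: the
    chain infects the edge f0 of its first copy.  By balancedness, with both ends
    of that edge fixed, any s of the other vertices span at most lambda s edges of
    the chain, except that the whole chain spans one more.  Hence for
    p = n^(-1/lambda + eps) and L large the second moment method finds a chain
    with probability 1 - O(n^(-eps)); running it in boundedly many disjoint blocks
    of vertices makes the failure probability o(n^(-2)). *)


(** * Random subsets of a finite set *)

Section RandomSubset.
Variables (R : realType) (A : finType) (p : R).
Implicit Types (D E F : {set A}) (X Y : {set A} -> R).

(** Expectation of [X] over a random subset of [D] that keeps each element independently with
    probability [p], written as a finite weighted sum. *)
Definition Ex D X : R :=
  \sum_(E in powerset D) p ^+ #|E| * (1 - p) ^+ (#|D| - #|E|) * X E.

Lemma eq_Ex D X Y : (forall E, E \subset D -> X E = Y E) -> Ex D X = Ex D Y.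
Proof. by move=> eXY; apply: eq_bigr => E; rewrite powersetE => /eXY ->. Qed.

Lemma ExD D X Y : Ex D (fun E => X E + Y E) = Ex D X + Ex D Y.
Proof. by rewrite -big_split; apply: eq_bigr => E _; rewrite mulrDr. Qed.

Lemma ExZ D c X : Ex D (fun E => c * X E) = c * Ex D X.
Proof. by rewrite /Ex mulr_sumr; apply: eq_bigr => E _; rewrite mulrCA. Qed.

Lemma Ex_sum (I : finType) (P : pred I) D (X : I -> {set A} -> R) :
  Ex D (fun E => \sum_(i | P i) X i E) = \sum_(i | P i) Ex D (X i).
Proof. by rewrite exchange_big; apply: eq_bigr => E _; rewrite mulr_sumr. Qed.

(** Fubini for independent parts: subsets of [D1 :|: D2] correspond to pairs of subsets by
    intersecting with [D1] and [D2], and the weights multiply. *)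
Lemma Ex_split D1 D2 X : [disjoint D1 & D2] ->
  Ex (D1 :|: D2) X = Ex D1 (fun E1 => Ex D2 (fun E2 => X (E1 :|: E2))).
Proof.
move=> dis; have D120 : D1 :&: D2 = set0 by apply/eqP; rewrite setI_eq0.
have cap1 E1 E2 : E1 \subset D1 -> E2 \subset D2 -> (E1 :|: E2) :&: D1 = E1.
  move=> s1 s2; rewrite setIUl (setIidPl s1) -[RHS]setU0.
  congr (_ :|: _); apply/eqP; rewrite -subset0 -D120 setIC.
  exact: setIS.
have cap2 E1 E2 : E1 \subset D1 -> E2 \subset D2 -> (E1 :|: E2) :&: D2 = E2.
  move=> s1 s2; rewrite setIUl (setIidPl s2) -[RHS]set0U.
  congr (_ :|: _); apply/eqP; rewrite -subset0 -D120.
  exact: setSI.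
transitivity (\sum_(E1 in powerset D1) \sum_(E2 in powerset D2)
   p ^+ #|E1 :|: E2| * (1 - p) ^+ (#|D1 :|: D2| - #|E1 :|: E2|) * X (E1 :|: E2)).
  rewrite pair_big /= /Ex.
  rewrite (reindex_onto (fun u : {set A} * {set A} => u.1 :|: u.2)
    (fun E => (E :&: D1, E :&: D2))) /=.
    apply: eq_bigl => -[E1 E2] /=; rewrite !powersetE.
    apply/andP/andP => [[sU /eqP[<- <-]]|[s1 s2]].
      by rewrite !subsetIr.
    by rewrite setUSS // cap1 // cap2 // eqxx.
  move=> E; rewrite powersetE => sE.
  by rewrite -setIUr; apply/setIidPl.
apply: eq_bigr => E1; rewrite powersetE => s1.
rewrite /Ex mulr_sumr; apply: eq_bigr => E2; rewrite powersetE => s2.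
rewrite mulrA; congr (_ * _).
have dE : [disjoint E1 & E2] by apply: disjointWl s1 _; apply: disjointWr s2 _.
have c1 := subset_leq_card s1; have c2 := subset_leq_card s2.
rewrite !cardsU D120 (disjoint_setI0 dE) !cards0 !subn0 exprD.
rewrite (_ : (_ - _ = (#|D1| - #|E1|) + (#|D2| - #|E2|))%N); last by lia.
by rewrite exprD; ring.
Qed.

Lemma Ex_set1 e X : Ex [set e] X = p * X [set e] + (1 - p) * X set0.
Proof.
rewrite /Ex powerset1 big_setU1 ?inE 1?eq_sym; last first.
  by apply/eqP => /setP/(_ e); rewrite !inE eqxx.
by rewrite big_set1 /= !cards1 cards0 subnn subn0 !expr1 !expr0 mulr1 mul1r addrC.
Qed.

(** Independence of the single elements, by splitting off one at a time. With [u = v = 1] it gives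
    total mass one; with [v = 1] and constant [u] it gives the moment generating function behind the
    Chernoff bound. *)
Lemma Ex_prod D (u v : A -> R) :
  Ex D (fun E => \prod_(e in D) (if e \in E then u e else v e))
  = \prod_(e in D) (p * u e + (1 - p) * v e).
Proof.
elim: {D}_.+1 {-2}D (ltnSn #|D|) => // m IH D.
have [->|[e eD]] := set_0Vmem D.
  by rewrite !big_set0 /Ex powerset0 big_set1 big_set0 cards0 !expr0 !mulr1.
rewrite (cardsD1 e) eD add1n !ltnS => cD.
rewrite -{1}(setD1K eD) Ex_split; last first.
  by rewrite disjoints1 !inE eqxx.
rewrite Ex_set1 (big_setD1 e eD) /= -IH //.
rewrite [RHS]mulrDl -!mulrA -!ExZ; congr (_ + _).
  apply: eq_Ex => E sE; congr (_ * _).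
  rewrite (big_setD1 e eD) /= !inE eqxx /=; congr (_ * _).
  apply: eq_bigr => x; rewrite !inE => /andP[/negPf xe _].
  by rewrite xe.
apply: eq_Ex => E sE; congr (_ * _).
have eE : e \notin E.
  by apply/negP => /(subsetP sE); rewrite !inE eqxx.
rewrite (big_setD1 e eD) /= !inE (negPf eE) /=; congr (_ * _).
by apply: eq_bigr => x; rewrite !inE.
Qed.

Lemma Ex_cst D c : Ex D (fun=> c) = c.
Proof.
transitivity (Ex D (fun E => c * \prod_(e in D) (if e \in E then 1 else 1))).
  by apply: eq_Ex => E _; rewrite big1 ?mulr1 // => e _; case: ifP.
rewrite ExZ Ex_prod big1 ?mulr1 // => e _; ring.
Qed.

Lemma Ex_restrict D F X : F \subset D ->
  Ex D (fun E => X (E :&: F)) = Ex F X.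
Proof.
move=> sF; rewrite -{1}(setID D F) (setIidPr sF) Ex_split; last first.
  by rewrite disjoints_subset setCD subsetUr.
apply: eq_Ex => E sE; rewrite -[RHS](Ex_cst (D :\: F)).
apply: eq_Ex => E2; rewrite subsetD => /andP[_ dis].
by rewrite setIUl (setIidPl sE) (disjoint_setI0 dis) setU0.
Qed.

Lemma Ex_sub D F : F \subset D -> Ex D (fun E => (F \subset E)%:R) = p ^+ #|F|.
Proof.
move=> sF.
rewrite (eq_Ex (Y := fun E => (F \subset E :&: F)%:R)); last first.
  by move=> E _; rewrite subsetI subxx andbT.
rewrite (Ex_restrict (fun E => (F \subset E)%:R) sF) /Ex (bigD1 F) ?powersetE //=.
rewrite subxx subnn expr0 !mulr1 big1 ?addr0 // => E.
rewrite powersetE eqEsubset => /andP[-> /= /negPf ->]; exact: mulr0.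
Qed.

Lemma Ex_pow D F x : F \subset D ->
  Ex D (fun E => x ^+ #|E :&: F|) = (1 + p * (x - 1)) ^+ #|F|.
Proof.
move=> sF; rewrite (Ex_restrict (fun E => x ^+ #|E|) sF).
transitivity (Ex F (fun E => \prod_(e in F) (if e \in E then x else 1))).
  apply: eq_Ex => E sE; rewrite -big_mkcondr /= (eq_bigl (mem E)) ?prodr_const // => e.
  by rewrite andbC /=; case: (boolP (e \in E)) => // /(subsetP sE).
rewrite Ex_prod prodr_const; congr (_ ^+ _); ring.
Qed.

Lemma Ex_indep D D1 D2 X Y : D1 \subset D -> [disjoint D1 & D2] ->
  (forall E, X E = X (E :&: D1)) -> (forall E, Y E = Y (E :&: D2)) ->
  Ex D (fun E => X E * Y E) = Ex D X * Ex D Y.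
Proof.
move=> s1 dis hX hY; rewrite -{1}(setID D D1) (setIidPr s1) Ex_split; last first.
  by rewrite disjoints_subset setCD subsetUr.
transitivity (Ex D1 (fun E1 => Ex (D :\: D1) Y * X E1)).
  apply: eq_Ex => E1 sE1; rewrite mulrC -ExZ; apply: eq_Ex => E2.
  rewrite subsetD => /andP[_ dE2]; congr (_ * _).
    by rewrite hX setIUl (setIidPl sE1) (disjoint_setI0 dE2) setU0.
  rewrite hY setIUl (_ : E1 :&: D2 = set0) ?set0U -?hY //.
  by apply: disjoint_setI0; apply: disjointWl dis.
rewrite ExZ mulrC; congr (_ * _).
  rewrite -(Ex_restrict X s1); apply: eq_Ex => E _; exact/esym/hX.
rewrite -(Ex_restrict Y (subsetDl D D1)); apply: eq_Ex => E sE.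
rewrite hY [in RHS]hY; congr Y; apply/setP => e; rewrite !inE.
case: (boolP (e \in D2)) => e2; rewrite ?andbF // !andbT.
have -> : e \in D1 = false by apply: (disjointFl dis).
by case: (boolP (e \in E)) => // /(subsetP sE) ->.
Qed.

Lemma Ex_indep_prod (I : finType) D (Dj : I -> {set A}) (X : I -> {set A} -> R) (s : seq I) :
  uniq s -> (forall i, Dj i \subset D) ->
  (forall i j, i != j -> [disjoint Dj i & Dj j]) ->
  (forall i E, X i E = X i (E :&: Dj i)) ->
  Ex D (fun E => \prod_(i <- s) X i E) = \prod_(i <- s) Ex D (X i).
Proof.
move=> us sD dD hX; elim: s us => [_|i s IH /= /andP[ns us]].
  by rewrite big_nil -[RHS](Ex_cst D); apply: eq_Ex => E _; rewrite big_nil.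
rewrite big_cons -IH // -(@Ex_indep _ (Dj i) (\bigcup_(j in s) Dj j)%SET) //.
- by apply: eq_Ex => E _; rewrite big_cons.
- rewrite disjoint_sym disjoints_subset; apply/bigcupsP => j js.
  rewrite -disjoints_subset; apply: dD; apply: contra ns => /eqP <- //.
- move=> E; apply: eq_big_seq => j js.
  rewrite hX [RHS]hX -setIA; congr (X j (_ :&: _)).
  by apply/esym/setIidPr; apply: bigcup_sup js.
Qed.

Hypothesis p01 : 0 <= p <= 1.

Lemma ler_Ex D X Y : (forall E, E \subset D -> X E <= Y E) -> Ex D X <= Ex D Y.
Proof.
move=> h; apply: ler_sum => E; rewrite powersetE => /h h1.
by apply: ler_wpM2l => //; apply: mulr_ge0; apply: exprn_ge0; move: p01; lra.
Qed.

Lemma Ex_ge0 D X : (forall E, E \subset D -> 0 <= X E) -> 0 <= Ex D X.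
Proof. by move=> h; rewrite -(Ex_cst D 0); apply: ler_Ex. Qed.

End RandomSubset.

(** * Events of the binomial random graph *)

Section Gnp.
Variables (R : realType) (T : finType) (p : R).
Hypothesis p01 : 0 <= p <= 1.
Implicit Type P Q : {set {set T}} -> Prop.

Lemma gnp_probE P : gnp_prob p P = Ex p (pairs T) (fun E => (`[< P E >])%:R).
Proof.
rewrite /gnp_prob big_mkcondr /=; apply: eq_bigr => E _.
by case: asboolP => _; rewrite ?mulr1 ?mulr0.
Qed.

Lemma ler_gnp P Q : (forall E : {set {set T}}, E \subset pairs T -> P E -> Q E) ->
  gnp_prob p P <= gnp_prob p Q.
Proof.
move=> h; rewrite !gnp_probE; apply: ler_Ex => // E sE.
rewrite ler_nat; case: asboolP => // PE; case: asboolP => // nQ.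
by case: nQ; apply: h.
Qed.

Lemma gnp_ge0 P : 0 <= gnp_prob p P.
Proof. by rewrite gnp_probE; apply: Ex_ge0. Qed.

Lemma gnpC P : gnp_prob p (fun E => ~ P E) = 1 - gnp_prob p P.
Proof.
rewrite !gnp_probE -[X in X - _](Ex_cst p (pairs T)) -mulN1r -ExZ -ExD.
apply: eq_Ex => E _; rewrite mulN1r.
by case: (asboolP (~ _)); case: asboolP => //=; rewrite ?subrr ?subr0.
Qed.

Lemma gnp_le1 P : gnp_prob p P <= 1.
Proof. by have := gnp_ge0 (fun E => ~ P E); rewrite gnpC subr_ge0. Qed.

Lemma gnp_union (I : finType) (B : pred I) (P : I -> {set {set T}} -> Prop) Q :
  (forall E : {set {set T}}, E \subset pairs T -> Q E -> exists2 i, B i & P i E) ->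
  gnp_prob p Q <= \sum_(i | B i) gnp_prob p (P i).
Proof.
move=> h; under eq_bigr do rewrite gnp_probE; rewrite gnp_probE -Ex_sum.
apply: ler_Ex => // E sE; case: asboolP => [QE|_]; last exact: sumr_ge0.
have [i Bi Pi] := h E sE QE.
rewrite (bigD1 i) //= ; case: asboolP => // _; rewrite lerDl; exact: sumr_ge0.
Qed.

Lemma gnp_markov P (X : {set {set T}} -> R) :
  (forall E : {set {set T}}, E \subset pairs T -> 0 <= X E) ->
  (forall E : {set {set T}}, E \subset pairs T -> P E -> 1 <= X E) ->
  gnp_prob p P <= Ex p (pairs T) X.
Proof.
move=> X0 X1; rewrite gnp_probE; apply: ler_Ex => // E sE.
by case: asboolP => [/X1|_]; [apply|apply: X0].
Qed.

End Gnp.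


Definition eIn (T : finType) (E : {set {set T}}) (S : {set T}) : nat :=
  #|[set h in E | h \subset S]|.

(** * Tight sets: percolation forces dense vertex sets *)

Section Tight.
Variables (n : nat) (G : {set {set 'I_n}}) (a b L C : nat).
Hypothesis Gpairs : G \subset pairs 'I_n.
Hypothesis L2 : (2 <= L)%N.
Hypothesis CL : (2 * L <= C)%N.

Let g (s : nat) : nat := (a * (s - 2) + b)%N.

Hypothesis gap : forall X : {set 'I_n}, (L < #|X| <= C)%N -> (b * eIn G X < g #|X|)%N.

(* Weights are scaled by [b], so that they become integers and a maximal one
   exists; [a / b] is lambda and [g #|X| / b] is lambda (|X| - 2) + 1. *)
Let W := {ffun {set 'I_n} -> 'I_b.+1}.
Let wt (w : W) (X : {set 'I_n}) : nat := (\sum_(e in G | e \subset X) w e)%N.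
Let feas (w : W) : bool :=
  [forall X : {set 'I_n}, (2 <= #|X| <= L)%N ==> (wt w X <= g #|X|)%N].
Let w0 : W := [ffun=> ord0].

Lemma feas0 : feas w0.
Proof. by apply/forallP => X; apply/implyP => _; rewrite /wt big1 // => e _; rewrite ffunE. Qed.

Let w : W := [arg max_(w > w0 | feas w) (\sum_(e in G) w e)%N].

Lemma feasw : feas w.
Proof. by rewrite /w; case: arg_maxnP => //; apply: feas0. Qed.

Lemma maxw (w' : W) : feas w' -> (\sum_(e in G) w' e <= \sum_(e in G) w e)%N.
Proof. by rewrite /w; case: arg_maxnP => [|w'' _ h]; [apply: feas0|apply: h]. Qed.

Definition tight (X : {set 'I_n}) : bool := (2 <= #|X| <= L)%N && (wt w X == g #|X|).

Lemma wt_le (X : {set 'I_n}) : (wt w X <= b * eIn G X)%N.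
Proof.
rewrite /wt /eIn -sum1dep_card big_distrr /= muln1.
by apply: leq_sum => e _; rewrite -ltnS.
Qed.

(** Feasibility bounds only sets of size at most [L]. As [wt w X <= b * eIn G X], the hypothesis
    [gap] forces a set of size at most [C] that reaches weight [g #|X|] back to size at most [L]. *)
Lemma tightI (X : {set 'I_n}) : (2 <= #|X| <= C)%N -> (g #|X| <= wt w X)%N -> tight X.
Proof.
move=> /andP[X2 XC] h; have XL : (#|X| <= L)%N.
  rewrite leqNgt; apply/negP => LX; have := @gap X; rewrite LX XC => /(_ isT).
  by rewrite ltnNge (leq_trans h (wt_le X)).
rewrite /tight X2 XL /= eqn_leq h andbT.
by have /forallP/(_ X) := feasw; rewrite X2 XL.
Qed.

(** If [w e = b], the pair [e] is itself tight, as [g 2 = b]. Otherwise, by maximality, raising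
    [w e] by one breaks some constraint, and that constraint was an equality on a set containing
    [e]. *)
Lemma cover_tight e : e \in G -> exists2 X, tight X & e \subset X.
Proof.
move=> eG; have ce : #|e| = 2%N by have := fintype.subsetP Gpairs e eG; rewrite inE => /eqP.
have [we|we] := leqP b (w e).
  exists e => //; apply: tightI; first by rewrite ce; lia.
  by rewrite /g ce /wt (bigD1 e) /= ?eG ?subxx //; lia.
pose w' : W := [ffun x => if x == e then inord (w e).+1 else w x].
have w'e : w' e = (w e).+1 :> nat by rewrite ffunE eqxx inordK.
have w'x x : x != e -> w' x = w x by rewrite ffunE => /negPf ->.
have wt' X : wt w' X = (wt w X + (e \subset X))%N.
  rewrite /wt; case: (boolP (e \subset X)) => eX.
    rewrite (bigD1 e) /= ?eG ?eX // [in RHS](bigD1 e) /= ?eG ?eX // w'e.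
    rewrite addn1 addSn; congr (_ + _).+1; apply: eq_bigr => x /andP[_ xe].
    by rewrite w'x.
  rewrite addn0; apply: eq_bigr => x /andP[_ xX]; rewrite w'x //.
  by apply: contraNneq eX => <-.
have : ~~ feas w'.
  apply/negP => /maxw; rewrite (bigD1 e) //= [in X in (_ <= X)%N](bigD1 e) //= w'e.
  rewrite (eq_bigr (fun x => w x : nat)); first by rewrite addSn ltnn.
  by move=> x /andP[_ xe]; rewrite w'x.
rewrite negb_forall => /existsP[X]; rewrite negb_imply -ltnNge wt' => /andP[X2 lX].
have /forallP/(_ X) := feasw; rewrite X2 /= => lX2.
have eX : e \subset X by apply: contraTT lX => /negPf ->; rewrite addn0 -leqNgt.
exists X => //; rewrite /tight X2 eqn_leq lX2 /=.
by move: lX; rewrite eX addn1 ltnS.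
Qed.

(** Since [g] is affine from size 2 on, [g #|X| + g #|Y| = g #|X :|: Y| + g #|X :&: Y|]. Feasibility
    of the intersection then leaves weight at least [g #|X :|: Y|] for the union, whose size is at
    most [2 * L <= C]. *)
Lemma tightU (X Y : {set 'I_n}) : tight X -> tight Y -> (2 <= #|X :&: Y|)%N -> tight (X :|: Y).
Proof.
move=> /andP[/andP[X2 XL] /eqP wX] /andP[/andP[Y2 YL] /eqP wY] I2.
have cU := cardsUI X Y.
have sIX := subset_leq_card (subsetIl X Y).
have sIY := subset_leq_card (subsetIr X Y).
apply: tightI; first by apply/andP; split; lia.
have wI : (wt w (X :&: Y) <= g #|X :&: Y|)%N.
  have /forallP/(_ (X :&: Y)) := feasw; rewrite I2 /= => /implyP; apply.
  by apply: leq_trans XL; apply: subset_leq_card; apply: subsetIl.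
(* Supermodularity of [wt w] uncrosses the two tight sets. *)
have super : (wt w X + wt w Y <= wt w (X :|: Y) + wt w (X :&: Y))%N.
  rewrite /wt !big_mkcondr -!big_split /=.
  apply: leq_sum => e _; rewrite subsetI.
  case: (boolP (e \subset X)) => eX; case: (boolP (e \subset Y)) => eY /=;
    rewrite ?(subset_trans eX (subsetUl X Y)) ?(subset_trans eY (subsetUr X Y)) ?addn0 ?leq_addr //.
rewrite wX wY in super; move: wI super; rewrite /g; nia.
Qed.

Lemma tight_max (e : {set 'I_n}) : (exists2 X, tight X & e \subset X) ->
  exists X, [/\ tight X, e \subset X &
    forall Y, tight Y -> (2 <= #|X :&: Y|)%N -> Y \subset X].
Proof.
case=> X0 t0 e0.
have P0 : tight X0 && (e \subset X0) by rewrite t0.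
case: (@arg_maxnP _ X0 (fun X => tight X && (e \subset X)) (fun X => #|X|) P0).
move=> X /andP[tX eX] mX; exists X; split=> // Y tY I2.
have := mX (X :|: Y); rewrite tightU //= (subset_trans eX (subsetUl _ _)) => /(_ isT) le.
have /eqP -> : X == X :|: Y by rewrite eqEcard subsetUl.
exact: subsetUr.
Qed.

Variables (k : nat) (EH : {set {set 'I_k}}).
Hypothesis EHpairs : EH \subset pairs 'I_k.
Hypothesis k2 : (2 <= k)%N.
Hypothesis eH2 : (2 <= #|EH|)%N.
Hypothesis ha : a = (#|EH| - 2)%N.
Hypothesis hb : b = (k - 2)%N.
Hypothesis hC : C = (k + #|EH| * L)%N.
Hypothesis bal : forall S : {set 'I_k}, (2 <= #|S| < k)%N ->
  (b * eIn EH S <= a * (#|S| - 2) + b)%N.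

Definition active (e : {set 'I_n}) : Prop := exists2 X, tight X & e \subset X.

(** Otherwise the other edges of the copy lie in maximal tight sets, distinct ones sharing at most
    one vertex and none containing the whole copy. Balancedness of [EH] on their traces shows that
    the union of these sets with the copy is tight, and it contains the last edge. *)
Lemma active_copy (f : 'I_k -> 'I_n) (h0 : {set 'I_k}) : injective f -> h0 \in EH ->
  (forall h, h \in EH -> h != h0 -> active (f @: h)) -> active (f @: h0).
Proof.
move=> injf h0E hact; apply: contrapT => nact.
have mx (h : {set 'I_k}) : exists X : {set 'I_n}, h \in EH -> h != h0 ->
    [/\ tight X, f @: h \subset X &
      forall Y, tight Y -> (2 <= #|X :&: Y|)%N -> Y \subset X].
  case: (boolP (h \in EH)) => hE; last by exists set0.
  case: (boolP (h != h0)) => hh; last by exists set0.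
  by have [X hX] := tight_max (hact h hE hh); exists X.
pose M h := projT1 (cid (mx h)).
have MP h : h \in EH -> h != h0 -> [/\ tight (M h), f @: h \subset M h &
      forall Y, tight Y -> (2 <= #|M h :&: Y|)%N -> Y \subset M h].
  by move=> hE hh; apply: (projT2 (cid (mx h))).
pose J : {set {set 'I_n}} := M @: (EH :\ h0).
have JP X : X \in J -> tight X /\
    (forall Y, tight Y -> (2 <= #|X :&: Y|)%N -> Y \subset X).
  by case/imsetP => h; rewrite !inE => /andP[hh hE] ->; have [] := MP h hE hh.
have Juniq X Y : X \in J -> Y \in J -> (2 <= #|X :&: Y|)%N -> X = Y.
  move=> /JP[tX mX] /JP[tY mY] I2; apply/eqP; rewrite eqEsubset.
  by rewrite mX // mY // setIC.
pose S (X : {set 'I_n}) : {set 'I_k} := f @^-1: X.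
have ch h : h \in EH -> #|h| = 2%N.
  by move=> hE; have := fintype.subsetP EHpairs h hE; rewrite inE => /eqP.
(* A trace equal to all of ['I_k] would put [f @: h0] inside a tight set, against [nact]. *)
have SX X : X \in J -> (2 <= #|S X| < k)%N.
  case/imsetP => h; rewrite !inE => /andP[hh hE] ->.
  have [tM sM _] := MP h hE hh.
  have hS : h \subset S (M h) by rewrite -sub_imset_pre.
  have := subset_leq_card hS; rewrite (ch h hE) => -> /=.
  rewrite ltn_neqAle -[X in (_ <= X)%N](card_ord k) max_card andbT.
  apply/eqP => cS; apply: nact; exists (M h) => //; rewrite sub_imset_pre -/(S _).
  suff -> : S (M h) = setT by apply: subsetT.
  by apply/eqP; rewrite eqEcard subsetT cS cardsT card_ord leqnn.
have cov : (#|EH| - 1 <= \sum_(X in J) eIn EH (S X))%N.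
  have -> : (#|EH| - 1 = #|EH :\ h0|)%N by rewrite (cardsD1 h0 EH) h0E addKn.
  rewrite -sum1_card (partition_big M (mem J)) /=; last first.
    by move=> h hE; apply: imset_f.
  apply: leq_sum => X XJ; rewrite sum1dep_card; apply: subset_leq_card.
  apply/fintype.subsetP => h; rewrite !inE => /andP[/andP[hh hE] /eqP <-].
  by rewrite hE -sub_imset_pre; have [] := MP h hE hh.
pose V := (f @: setT) :|: (\bigcup_(X in J) X)%SET.
have cV : (#|V| <= k + \sum_(X in J) (#|X| - #|S X|))%N.
  have -> : V = (f @: setT) :|: (\bigcup_(X in J) (X :\: f @: setT))%SET.
    apply/setP => x; rewrite !inE; case: (boolP (x \in f @: setT)) => //= xf.
    apply/bigcupP/bigcupP => -[X XJ xX]; exists X => //.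
      by rewrite inE xf.
    by move: xX; rewrite inE => /andP[].
  apply: (leq_trans (leq_card_setU _ _).1); apply: leq_add.
    by rewrite card_imset // cardsT card_ord.
  apply: (@leq_trans (\sum_(X in J) #|X :\: f @: setT|)).
    elim/big_ind2: _ => [|m1 A1 m2 A2 h1 h2|//]; first by rewrite cards0.
    by apply: leq_trans (leq_card_setU _ _).1 (leq_add h1 h2).
  apply: leq_sum => X _; rewrite cardsD leq_sub2l // -(card_imset _ injf).
  apply: subset_leq_card; apply/fintype.subsetP => x /imsetP[y]; rewrite inE => yX ->.
  by rewrite inE yX imset_f // inE.
have JE : (#|J| <= #|EH|)%N.
  by apply: leq_trans (leq_imset_card _ _) _; apply: subset_leq_card; apply: subsetDl.
have tightJ X : X \in J -> [/\ (#|S X| <= #|X|)%N, (2 <= #|X| <= L)%N & wt w X = g #|X|].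
  move=> XJ; have [/andP[X2 /eqP ->] _] := JP X XJ; split=> //.
  rewrite -(card_imset _ injf); apply: subset_leq_card.
  by apply/fintype.subsetP => x /imsetP[y]; rewrite inE => yX ->.
have VC : (2 <= #|V| <= C)%N.
  apply/andP; split.
    apply: (@leq_trans #|f @: setT|); last by apply: subset_leq_card; apply: subsetUl.
    by rewrite card_imset // cardsT card_ord.
  apply: leq_trans cV _; rewrite hC leq_add2l.
  apply: (@leq_trans (\sum_(X in J) L)); last by rewrite sum_nat_const leq_mul2r JE orbT.
  by apply: leq_sum => X /tightJ[_ /andP[_ XL] _]; rewrite (leq_trans (leq_subr _ _)).
(* An edge of [G] lies in at most one member of [J], since two members sharing its two ends
   coincide; so nothing is counted twice. *)
have wV : (\sum_(X in J) wt w X <= wt w V)%N.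
  rewrite /wt (exchange_big_dep (fun e => e \in G)) /=; last by move=> X e _ /andP[].
  rewrite [X in (_ <= X)%N]big_mkcondr /=.
  apply: leq_sum => e eG.
  have ce : #|e| = 2%N by have := fintype.subsetP Gpairs e eG; rewrite inE => /eqP.
  case: (pickP (fun X => (X \in J) && (e \subset X))) => [X /andP[XJ eX]|none].
    rewrite (bigD1 X) /= ?XJ ?eG ?eX // big1 => [|Y /andP[/andP[YJ /andP[_ eY]] YX]].
      rewrite addn0 (subset_trans eX) //.
      by apply: subset_trans (subsetUr _ _); apply: bigcup_sup.
    case/negP: YX; apply/eqP; apply: Juniq => //; rewrite -ce; apply: subset_leq_card.
    by rewrite subsetI eX eY.
  rewrite big_pred0 // => X; have := none X; by rewrite eG /=.
apply: nact; exists V; last first.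
  apply: subset_trans (subsetUl _ _); apply: imsetS; exact: subsetT.
apply: tightI => //; apply: leq_trans wV.
have -> : (\sum_(X in J) wt w X = \sum_(X in J) (a * (#|X| - #|S X|) + (a * (#|S X| - 2) + b)))%N.
  apply: eq_bigr => X XJ; have [sX X2 ->] := tightJ X XJ; have := SX X XJ.
  by rewrite /g => /andP[s2 _]; rewrite addnA -mulnDr; congr (_ * _ + _)%N; lia.
rewrite big_split -big_distrr /=.
have balS : (b * (#|EH| - 1) <= \sum_(X in J) (a * (#|S X| - 2) + b))%N.
  apply: (@leq_trans (b * \sum_(X in J) eIn EH (S X))%N); first by rewrite leq_mul2l cov orbT.
  by rewrite big_distrr; apply: leq_sum => X /SX; apply: bal.
set s1 := (\sum_(X in J) (#|X| - #|S X|))%N in cV *.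
move: balS; set s2 := (\sum_(X in J) _)%N => balS.
apply: (@leq_trans (a * (k + s1 - 2) + b)%N).
  by rewrite leq_add2r leq_mul2l leq_sub2r ?orbT.
have -> : (k + s1 - 2 = b + s1)%N by rewrite hb; lia.
(* Hence [b * (#|EH| - 1) = a * (k - 2) + b], which is exactly [g k], the share of the copy
   itself. *)
have e1 : (#|EH| - 1 = a.+1)%N by rewrite ha; lia.
by move: balS; rewrite e1 mulnDr mulnS; lia.
Qed.

Lemma perc_active t e : e \in iter t (perc_step EH) G -> active e.
Proof.
elim: t e => [|t IH] e; first exact: cover_tight.
rewrite iterS /perc_step in_setU => /orP[/IH //|].
rewrite inE => /andP[_ /andP[eN /existsP[f /and3P[/injectiveP injf /forallP hf]]]].
case/existsP => h0 /andP[h0E /eqP fh0]; rewrite -fh0.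
apply: active_copy => // h hE hh0; apply: IH.
have := hf h; rewrite hE /= in_setU1 -fh0 => /orP[/eqP/imset_inj E|//].
by case/negP: hh0; apply/eqP/E.
Qed.

Lemma percolates_dense (e : {set 'I_n}) : percolates EH G -> e \in pairs 'I_n ->
  exists X : {set 'I_n}, [/\ e \subset X, (2 <= #|X| <= L)%N & (g #|X| <= b * eIn G X)%N].
Proof.
move=> pG eP; have [t /perc_active[X tX eX]] := (pG e).2 eP.
exists X; case/andP: tX => X2 /eqP wX; split=> //; rewrite -wX; exact: wt_le.
Qed.

End Tight.


(** * Second moment method for partite configurations *)

Section SecondMoment.
(* Coordinate [t : T] of a configuration has its own [N] choices, so two
   configurations share exactly the edges supported on the coordinates where
   they agree. *)
Variables (R : realType) (p : R) (A T J : finType) (D : {set A}) (N : nat).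
Variables (I : {set J}) (s : J -> {set T}) (ed : {ffun T -> 'I_N} -> J -> A).
Hypothesis p01 : 0 < p <= 1.
Hypothesis N0 : (0 < N)%N.
Hypothesis edD : forall f i, i \in I -> ed f i \in D.
Hypothesis ed_inj : forall f g i j, i \in I -> j \in I -> ed f i = ed g j ->
  i = j /\ forall t, t \in s i -> f t = g t.

Hypothesis s_neq0 : forall i, i \in I -> s i != set0.

Definition placed (f : {ffun T -> 'I_N}) : {set A} := ed f @: I.
Definition spanned (S : {set T}) : nat := #|[set i in I | s i \subset S]|.

Let agree (f g : {ffun T -> 'I_N}) : {set T} := [set t | f t == g t].
Let c : R := (N ^ #|T|)%:R.
Let mu : R := c * p ^+ #|I|.

Lemma card_placed f : #|placed f| = #|I|.
Proof. by rewrite card_in_imset // => i j iI jI /(ed_inj iI jI)[]. Qed.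

Lemma card_placedI f g : (#|placed f :&: placed g| <= spanned (agree f g))%N.
Proof.
apply: leq_trans (leq_imset_card (ed f) _).
apply: subset_leq_card; apply/fintype.subsetP => x.
rewrite inE => /andP[/imsetP[i iI ->] /imsetP[j jI] eij].
have [_ h] := ed_inj iI jI eij.
apply: imset_f; rewrite inE iI /=; apply/fintype.subsetP => t /h ft.
by rewrite inE ft.
Qed.

Lemma expr_placedU f g :
  p ^+ #|placed f :|: placed g| <= p ^+ #|I| * p ^+ #|I| / p ^+ spanned (agree f g).
Proof.
have /andP[p0 p1] := p01.
have p0' := ltW p0.
rewrite ler_pdivlMr ?exprn_gt0 // -!exprD.
apply: ler_wiXn2l => //.
have := cardsUI (placed f) (placed g); rewrite !card_placed => <-.
by rewrite leq_add2l card_placedI.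
Qed.

Lemma card_agree (S : {set T}) (f : {ffun T -> 'I_N}) :
  (#|[set g : {ffun T -> 'I_N} | agree f g == S]| * N ^ #|S| <= N ^ #|T|)%N.
Proof.
pose F t : pred 'I_N := if t \in S then pred1 (f t) else predT.
have le : (#|[set g : {ffun T -> 'I_N} | agree f g == S]| <= #|family F|)%N.
  apply: subset_leq_card; apply/fintype.subsetP => g; rewrite inE => /eqP eS.
  apply/familyP => t; rewrite /F -eS inE; case: ifP => // /eqP ->.
  by rewrite inE.
apply: leq_trans (leq_mul le (leqnn _)) _.
rewrite card_family foldrE big_map big_enum /=.
rewrite (bigID (fun t => t \in S)) /= big1 ?mul1n; last first.
  by move=> t tS; rewrite /F tS card1.
rewrite (eq_bigr (fun=> N)); last first.
  by move=> t /negPf tS; rewrite /F tS cardT size_enum_ord.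
rewrite prod_nat_const -expnD.
by rewrite -(cardC (mem S)) addnC /= leqnn.
Qed.

(** Chebyshev for the number [X] of placed configurations. Pairs are grouped by their agreement set
    [S]: the empty set contributes at most the square of the mean, and every other [S] at most one
    term of the sum relative to it. *)
Lemma second_moment :
  Ex p D (fun E => (~~ [exists f, placed f \subset E])%:R)
  <= \sum_(S : {set T} | S != set0) (N%:R ^+ #|S| * p ^+ spanned S)^-1.
Proof.
have /andP[p0 p1] := p01.
have p01' : 0 <= p <= 1 by rewrite ltW.
have NR : 0 < N%:R :> R by rewrite ltr0n.
have c0 : 0 < c by rewrite ltr0n expn_gt0 N0.
have mu0 : 0 < mu by rewrite mulr_gt0 // exprn_gt0.
set Q := \sum_(S | _) _.
pose X (E : {set A}) : R := \sum_f (placed f \subset E)%:R.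
have plD f : placed f \subset D.
  by apply/fintype.subsetP => x /imsetP[i iI ->]; apply: edD.
have cE : \sum_(f : {ffun T -> 'I_N}) 1 = c.
  by rewrite sumr_const card_ffun card_ord.
have EX : Ex p D X = mu.
  rewrite /X Ex_sum /mu -cE mulr_suml; apply: eq_bigr => f _.
  by rewrite Ex_sub // card_placed mul1r.
have EX2 : Ex p D (fun E => X E * X E) <= mu ^+ 2 * (1 + Q).
  pose G S : R := (p ^+ spanned S)^-1.
  have -> : Ex p D (fun E => X E * X E) =
     \sum_(u : {ffun T -> 'I_N} * {ffun T -> 'I_N}) p ^+ #|placed u.1 :|: placed u.2|.
    rewrite -(pair_bigA _ (fun f g => p ^+ #|placed f :|: placed g|)) /=.
    rewrite (@eq_Ex _ _ _ _ _ (fun E => \sum_f \sum_g (placed f :|: placed g \subset E)%:R)).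
      rewrite Ex_sum; apply: eq_bigr => f _; rewrite Ex_sum; apply: eq_bigr => g _.
      by rewrite Ex_sub // subUset !plD.
    move=> E _; rewrite /X mulr_suml; apply: eq_bigr => f _; rewrite mulr_sumr.
    by apply: eq_bigr => g _; rewrite subUset -natrM mulnb.
  apply: (@le_trans _ _ (\sum_(u : {ffun T -> 'I_N} * {ffun T -> 'I_N})
       p ^+ #|I| * p ^+ #|I| * G (agree u.1 u.2))).
    by apply: ler_sum => u _; apply: expr_placedU.
  rewrite -mulr_sumr (_ : mu ^+ 2 * (1 + Q) = p ^+ #|I| * p ^+ #|I| * (c ^+ 2 * (1 + Q))); last first.
    by rewrite /mu; ring.
  rewrite ler_wpM2l ?mulr_ge0 ?exprn_ge0 ?(ltW p0) //.
  rewrite (partition_big (fun u => agree u.1 u.2) predT) //=.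
  have bnd S : \sum_(u : {ffun T -> 'I_N} * {ffun T -> 'I_N} | agree u.1 u.2 == S) G (agree u.1 u.2)
      <= c ^+ 2 * (N%:R ^+ #|S| * p ^+ spanned S)^-1.
    rewrite (eq_bigr (fun=> G S)); last by move=> u /eqP ->.
    have -> : \sum_(u : {ffun T -> 'I_N} * {ffun T -> 'I_N} | agree u.1 u.2 == S) G S
       = \sum_(f : {ffun T -> 'I_N}) \sum_(g | agree f g == S) G S.
      by rewrite pair_big_dep.
    rewrite expr2 -{1}cE mulr_suml mulr_suml; apply: ler_sum => f _.
    rewrite mul1r invfM mulrA -/(G S) sumr_const -[X in X <= _]mulr_natl.
    apply: ler_wpM2r; first by rewrite invr_ge0 exprn_ge0 // ltW.
    rewrite ler_pdivlMr ?exprn_gt0 // -natrX -natrM ler_nat.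
    apply: leq_trans (card_agree S f); rewrite leq_mul2r; apply/orP; right.
    by rewrite cardsE.
  rewrite (bigD1 set0) //= mulrDr mulr1; apply: lerD; last first.
    by rewrite /Q mulr_sumr; apply: ler_sum => S _; apply: bnd.
  (* This is where [s_neq0] matters: configurations that agree nowhere share no edge. *)
  have sp0 : spanned set0 = 0%N.
    apply/eqP; rewrite cards_eq0 -subset0; apply/fintype.subsetP => i.
    by rewrite !inE subset0 => /andP[/s_neq0/negPf ->].
  by have := bnd set0; rewrite sp0 cards0 !expr0 mulr1 invr1 mulr1.
(* When [X E = 0], the indicator times [mu ^+ 2] equals the squared deviation. *)
rewrite -(ler_pM2l (exprn_gt0 2 mu0)).
apply: (@le_trans _ _ (Ex p D (fun E => (X E - mu) ^+ 2))).
  rewrite -ExZ; apply: ler_Ex => // E _; case: existsP => [_|nex] /=.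
    by rewrite mulr0 sqr_ge0.
  rewrite mulr1 /X big1 ?sub0r ?sqrrN // => f _.
  by case: (boolP (_ \subset _)) => // fE; case: nex; exists f.
rewrite (@eq_Ex _ _ _ _ _ (fun E => X E * X E + ((- 2 * mu) * X E + mu ^+ 2))); last first.
  by move=> E _; ring.
rewrite !ExD ExZ EX Ex_cst; move: EX2; rewrite mulrDr mulr1; lra.
Qed.

End SecondMoment.


(** * Chains of copies of H *)

Section Closure.
Variables (k n : nat) (EH : {set {set 'I_k}}) (G : {set {set 'I_n}}).
Hypothesis EHpairs : EH \subset pairs 'I_k.

Definition infected (e : {set 'I_n}) : Prop := exists t, e \in iter t (perc_step EH) G.

Lemma iter_perc_mono t u : (t <= u)%N -> iter t (perc_step EH) G \subset iter u (perc_step EH) G.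
Proof.
elim: u => [|u IH]; first by rewrite leqn0 => /eqP ->.
rewrite leq_eqVlt => /predU1P[->//|]; rewrite ltnS => /IH h.
by apply: subset_trans h _; rewrite iterS; apply: subsetUl.
Qed.

Lemma infected_pairs e : G \subset pairs 'I_n -> infected e -> e \in pairs 'I_n.
Proof.
move=> sG [t]; elim: t e => [|t IH] e; first by move/(fintype.subsetP sG).
by rewrite iterS in_setU => /orP[/IH //|]; rewrite in_set => /andP[].
Qed.

(** Only finitely many edges are involved, so the largest of their infection times serves for all of
    them. *)
Lemma infected_copy (f : 'I_k -> 'I_n) (h0 : {set 'I_k}) : injective f -> h0 \in EH ->
  (forall h, h \in EH -> h != h0 -> infected (f @: h)) -> infected (f @: h0).
Proof.
move=> injf h0E hact.
have [u hu] : exists u, forall h, h \in EH -> h != h0 -> f @: h \in iter u (perc_step EH) G.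
  have tx (h : {set 'I_k}) : exists t, h \in EH -> h != h0 -> f @: h \in iter t (perc_step EH) G.
    case: (boolP (h \in EH)) => hE; last by exists 0%N.
    case: (boolP (h != h0)) => hh; last by exists 0%N.
    by have [t ht] := hact h hE hh; exists t.
  pose t h := projT1 (cid (tx h)).
  exists (\max_(h : {set 'I_k}) t h)%N => h hE hh.
  apply: (fintype.subsetP (iter_perc_mono (leq_bigmax h))).
  exact: (projT2 (cid (tx h))).
exists u.+1; rewrite iterS in_setU.
have [//|nin] := boolP (f @: h0 \in iter u (perc_step EH) G).
rewrite in_set nin /=.
have ch : #|h0| = 2%N by have := fintype.subsetP EHpairs h0 h0E; rewrite inE => /eqP.
apply/andP; split; first by rewrite inE card_imset // ch.
apply/existsP; exists [ffun x => f x].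
have ef (h : {set 'I_k}) : [ffun x => f x] @: h = f @: h.
  by apply: eq_imset => x; rewrite ffunE.
apply/and3P; split.
- by apply/injectiveP => x y; rewrite !ffunE => /injf.
- apply/forallP => h; apply/implyP => hE; rewrite ef in_setU1.
  by have [->|hh] := eqVneq h h0; rewrite ?eqxx // hu ?orbT.
- by apply/existsP; exists h0; rewrite h0E ef eqxx.
Qed.

End Closure.

Section Chain.
Variables (k : nat) (EH : {set {set 'I_k}}) (u0 u1 w0 w1 : 'I_k).
Hypothesis EHpairs : EH \subset pairs 'I_k.
Let f0 : {set 'I_k} := [set u0; u1].
Let f1 : {set 'I_k} := [set w0; w1].
Hypothesis f0E : f0 \in EH.
Hypothesis uniq4 : uniq [:: u0; u1; w0; w1].
Variable L' : nat.
Let L := L'.+1.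
Let T := ('I_L * 'I_k)%type.

(* Name of vertex [x] in the [i]-th copy of H: [inl] for the two ends of the
   initial edge, [inr] for a coordinate.  The vertices [u0], [u1] of copy [i]
   are the vertices [w0], [w1] of copy [i - 1]; the coordinates [(i, u0)] and
   [(i, u1)] exist but name no vertex. *)
Definition key (i : 'I_L) (x : 'I_k) : bool + T :=
  if x == u0 then (if i == ord0 then inl false else inr (inord i.-1, w0))
  else if x == u1 then (if i == ord0 then inl true else inr (inord i.-1, w1))
  else inr (i, x).

(** Edges that must be present at the start. Each [f0] is left out because its copy creates it; [f1]
    is left out except in the last copy, since elsewhere the next copy supplies it. *)
Definition chain_edges : {set 'I_L * {set 'I_k}} :=
  [set ih : 'I_L * {set 'I_k} | [&& ih.2 \in EH, ih.2 != f0 & (ih.2 != f1) || (ih.1 == ord_max)]].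

Definition chain_supp (ih : 'I_L * {set 'I_k}) : {set T} :=
  [set t | inr t \in key ih.1 @: ih.2].

Lemma uniq4P : [/\ u0 != u1, w0 != w1, (w0 != u0) && (w0 != u1) & (w1 != u0) && (w1 != u1)].
Proof.
by move: uniq4; rewrite /= !inE !negb_or andbT -!andbA => /and5P[-> ? ? ? /andP[? ?]]; split;
  rewrite // ![_ == u0]eq_sym ![_ == u1]eq_sym; apply/andP; split.
Qed.

Lemma key_level (i : 'I_L) x (j : 'I_L) y : key i x = inr (j, y) -> (j <= i)%N.
Proof.
rewrite /key; case: (x == u0) => //; [|case: (x == u1)]; try by case=> <-.
all: case: (eqVneq i ord0) => // i0 [<- _]; rewrite inordK; first by rewrite leq_pred.
all: by apply: leq_ltn_trans (leq_pred _) (ltn_ord i).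
Qed.

Lemma key_inj i : injective (key i).
Proof.
have [h01 hw /andP[w00 w01] /andP[w10 w11]] := uniq4P.
move=> x y; rewrite /key.
have pi : i != ord0 -> (i : 'I_L) != inord i.-1.
  move=> i0; apply/eqP => /(congr1 val) /=; rewrite inordK; last first.
    by apply: leq_ltn_trans (leq_pred _) (ltn_ord i).
  have : (0 < i)%N by rewrite lt0n.
  by case: (i : nat) => //= m _ /eqP; rewrite eqn_leq ltnn.
case: (eqVneq x u0) => [->|x0]; case: (eqVneq y u0) => [->//|y0];
  try (case: (eqVneq x u1) => [->|x1]); try (case: (eqVneq y u1) => [->|y1]);
  case: (eqVneq i ord0) => // i0 [] //.
all: try by move=> e; move: (hw); rewrite e eqxx.
all: try by move=> e _; move: (pi i0); rewrite e eqxx.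
all: try by move=> e _; move: (pi i0); rewrite -e eqxx.
Qed.

(** Such a vertex keeps its own coordinate under [key i], which is what identifies the level of an
    edge. *)
Lemma edge_notf0 (h : {set 'I_k}) : h \in EH -> h != f0 -> exists2 x, x \in h & (x != u0) && (x != u1).
Proof.
move=> hE hf; have [h01 _ _ _] := uniq4P.
have ch : #|h| = 2%N by have := fintype.subsetP EHpairs h hE; rewrite inE => /eqP.
have : ~~ (h \subset f0).
  by apply: contra hf => sh; rewrite eqEcard sh ch cards2 h01.
by case/subsetPn => x xh; rewrite !inE negb_or => xf; exists x.
Qed.

Lemma key_id i x : (x != u0) && (x != u1) -> key i x = inr (i, x).
Proof. by case/andP => /negPf x0 /negPf x1; rewrite /key x0 x1. Qed.

Lemma key_succ (i j : 'I_L) : j = i.+1 :> nat -> key j @: f0 = key i @: f1.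
Proof.
move=> ji; have [h01 hw h0 h1] := uniq4P.
rewrite !imsetU1 !imset_set1 ?(key_id i h0) ?(key_id i h1) /key !eqxx.
rewrite [u1 == u0]eq_sym (negPf h01).
have -> : (j == ord0) = false by apply/negbTE; apply/eqP => /(congr1 val); rewrite /= ji.
by rewrite ji /= inord_val.
Qed.

Lemma chain_supp_neq0 ih : ih \in chain_edges -> chain_supp ih != set0.
Proof.
rewrite inE => /and3P[hE hf _]; have [x xh xu] := edge_notf0 hE hf.
apply/set0Pn; exists (ih.1, x); rewrite inE; apply/imsetP; exists x => //.
by rewrite key_id.
Qed.

Section Realize.
Variables (n N : nat) (r0 r1 : 'I_n) (pos : T -> 'I_N -> 'I_n).
Hypothesis r01 : r0 != r1.
Hypothesis pos_r : forall t c, (pos t c != r0) && (pos t c != r1).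
Hypothesis pos_inj : forall t c t' c', pos t c = pos t' c' -> t = t' /\ c = c'.
Implicit Types f g : {ffun T -> 'I_N}.

Definition realize f (y : bool + T) : 'I_n :=
  match y with inl b => if b then r1 else r0 | inr t => pos t (f t) end.

Lemma realize_inj f g y z : realize f y = realize g z ->
  y = z /\ forall t, y = inr t -> f t = g t.
Proof.
case: y z => [b|t] [b'|t'] /=.
- by case: b b' => -[] // /eqP; rewrite ?(negPf r01) // eq_sym (negPf r01).
- move=> /eqP; have /andP[/negPf h0 /negPf h1] := pos_r t' (g t').
  by case: b; rewrite eq_sym ?h0 ?h1.
- move=> /eqP; have /andP[/negPf h0 /negPf h1] := pos_r t (f t).
  by case: b'; rewrite ?h0 ?h1.
- by case/pos_inj => <- e; split=> // _ [<-].
Qed.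

Definition chain_edge f (ih : 'I_L * {set 'I_k}) : {set 'I_n} :=
  realize f @: (key ih.1 @: ih.2).

Lemma chain_edge_pairs f ih : ih \in chain_edges -> chain_edge f ih \in pairs 'I_n.
Proof.
rewrite inE => /and3P[/(fintype.subsetP EHpairs) + _ _]; rewrite !inE => /eqP <-.
rewrite /chain_edge !card_imset //; first exact: key_inj.
by move=> y z /realize_inj[].
Qed.

(** Names are recovered from vertices by [realize_inj]. The level of an edge is the largest one
    among its coordinates: [key_level] bounds those above, and a vertex off [f0] attains the
    bound. *)
Lemma chain_edge_inj f g ih jh : ih \in chain_edges -> jh \in chain_edges ->
  chain_edge f ih = chain_edge g jh ->
  ih = jh /\ forall t, t \in chain_supp ih -> f t = g t.
Proof.
have sub f' g' (Y Z : {set bool + T}) : realize f' @: Y = realize g' @: Z ->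
    forall y, y \in Y -> y \in Z /\ forall t, y = inr t -> f' t = g' t.
  move=> e y yY; have : realize f' y \in realize g' @: Z by rewrite -e imset_f.
  by case/imsetP => z zZ /realize_inj[yz h]; split=> //; rewrite yz.
move=> iI jI e.
have eK : key ih.1 @: ih.2 = key jh.1 @: jh.2.
  by apply/setP => y; apply/idP/idP => yY; [have [] := sub _ _ _ _ e y yY|
    have [] := sub _ _ _ _ (esym e) y yY].
split; last by move=> t; rewrite inE => tY; have [_] := sub _ _ _ _ e _ tY; apply.
have lev (ih' jh' : 'I_L * {set 'I_k}) : ih' \in chain_edges -> key ih'.1 @: ih'.2 = key jh'.1 @: jh'.2 ->
    (ih'.1 <= jh'.1)%N.
  rewrite inE => /and3P[hE hf _] eK'; have [x xh xu] := edge_notf0 hE hf.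
  have : key ih'.1 x \in key jh'.1 @: jh'.2 by rewrite -eK' imset_f.
  by rewrite key_id // => /imsetP[y _ /esym/key_level].
have e1 : ih.1 = jh.1 by apply: val_inj; apply/eqP; rewrite eqn_leq (lev ih jh) // (lev jh ih).
move: eK; rewrite e1 => /imset_inj => e2.
by rewrite [ih]surjective_pairing e1 e2 -?surjective_pairing //; apply: key_inj.
Qed.

(** Infection runs from the last copy back to the first: copy [i.+1] creates its [f0], which is the
    missing [f1] of copy [i]. The induction is on the distance [m] to the last level. *)
Lemma chain_infects (G : {set {set 'I_n}}) f :
  placed chain_edges chain_edge f \subset G -> infected EH G [set r0; r1].
Proof.
move=> sG.
have inj i : injective (realize f \o key i).
  by move=> x y /realize_inj[/key_inj].
have lvl m : forall i : 'I_L, (i + m = L')%N -> infected EH G (chain_edge f (i, f0)).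
  elim: m => [|m IH] i im; rewrite /chain_edge -imset_comp /=; apply: infected_copy => // h hE hf.
    exists 0%N; rewrite /=; apply: (fintype.subsetP sG).
    apply/imsetP; exists (i, h); last by rewrite /chain_edge -imset_comp.
    rewrite inE hE hf /=; apply/orP; right; apply/eqP; apply: val_inj => /=.
    by rewrite -[RHS]im addn0.
  have [hf1|hf1] := eqVneq h f1; last first.
    exists 0%N; rewrite /=; apply: (fintype.subsetP sG).
    apply/imsetP; exists (i, h); last by rewrite /chain_edge -imset_comp.
    by rewrite inE hE hf hf1.
  have iL : (i.+1 < L)%N by have := leq_addr m i.+1; rewrite addSnnS im.
  have := IH (Ordinal iL); rewrite /= addSn -addnS im => /(_ erefl).
  by rewrite /chain_edge (@key_succ i) // hf1 imset_comp.
have := lvl L' ord0; rewrite add0n => /(_ erefl).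
have [h01 _ _ _] := uniq4P.
rewrite /chain_edge /= !imsetU1 !imset_set1 /key !eqxx.
by rewrite [u1 == u0]eq_sym (negPf h01).
Qed.

End Realize.
End Chain.


(** * Edges spanned by a set of chain coordinates *)

Lemma card_pairs (A B : finType) (X : {set A * B}) :
  #|X| = (\sum_a #|[set b | (a, b) \in X]|)%N.
Proof.
under eq_bigr do rewrite -sum1dep_card.
rewrite pair_big_dep /= -sum1_card; apply: eq_bigl => -[a b] //.
Qed.

Section ChainCount.
Variables (k : nat) (EH : {set {set 'I_k}}) (u0 u1 w0 w1 : 'I_k).
Hypothesis EHpairs : EH \subset pairs 'I_k.
Let f0 : {set 'I_k} := [set u0; u1].
Let f1 : {set 'I_k} := [set w0; w1].
Hypothesis f0E : f0 \in EH.
Hypothesis f1E : f1 \in EH.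
Hypothesis uniq4 : uniq [:: u0; u1; w0; w1].
Variables (L' a b : nat).
Let L := L'.+1.
Let T := ('I_L * 'I_k)%type.
Hypothesis ha : a = (#|EH| - 2)%N.
Hypothesis hb : b = (k - 2)%N.
Hypothesis ba : (b <= a)%N.
Hypothesis bal : forall S : {set 'I_k}, (3 <= #|S| < k)%N ->
  (b * (eIn EH S).+1 <= a * (#|S| - 2))%N.

Variable S : {set T}.
(** [Sl i] is the part of [U i] charged to level [i]: the ends of its [f0] are either fixed or
    already charged to the previous level. *)
Let U (i : 'I_L) : {set 'I_k} :=
  [set x | match key u0 u1 w0 w1 i x with inl _ => true | inr t => t \in S end].
Let Sl (i : 'I_L) : {set 'I_k} := [set x | ((i, x) \in S) && (x \notin f0)].
Let c (i : 'I_L) : nat := #|[set h in EH | [&& h != f0, h != f1 & h \subset U i]]|.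
Let phi (i : 'I_L) : bool := f1 \subset U i.

Let f01 : f0 != f1.
Proof.
have [_ _ /andP[w00 w01] _] := uniq4P uniq4.
apply/eqP => /setP/(_ w0); rewrite !inE eqxx /=.
by rewrite (negPf w00) (negPf w01).
Qed.

Let U_out i x : x \notin f0 -> (x \in U i) = ((i, x) \in S).
Proof. by rewrite !inE negb_or => h; rewrite key_id. Qed.

Let UD i : U i :\: f0 = Sl i.
Proof.
apply/setP => x; rewrite in_setD [RHS]in_set andbC; case: (boolP (x \in f0)) => xf; rewrite ?andbF //=.
by rewrite U_out.
Qed.

Let card_f0 : #|f0| = 2%N.
Proof. by have [h01 _ _ _] := uniq4P uniq4; rewrite cards2 h01. Qed.

Let card_U i : #|U i| = (#|Sl i| + #|U i :&: f0|)%N.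
Proof. by rewrite -UD addnC cardsID. Qed.

Let card_h h : h \in EH -> #|h| = 2%N.
Proof. by move=> hE; have := fintype.subsetP EHpairs h hE; rewrite inE => /eqP. Qed.

Let Sl_le i : (#|Sl i| <= b)%N.
Proof.
have sS : Sl i \subset ~: f0.
  by apply/fintype.subsetP => x; rewrite !inE => /andP[].
have cC : #|~: f0| = b by rewrite cardsCs setCK card_f0 card_ord hb.
by rewrite -cC; apply: subset_leq_card.
Qed.

Let c_phi i : (c i + phi i <= eIn EH (U i))%N.
Proof.
rewrite /c /phi /eIn.
set X := [set h in EH | _]; set Y := [set h in EH | _].
have sXY : X \subset Y by apply/fintype.subsetP => h; rewrite !inE => /and4P[-> _ _ ->].
case: (boolP (f1 \subset U i)) => f1U; last by rewrite addn0 subset_leq_card.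
have <- : #|f1 |: X| = (#|X| + 1)%N.
  by rewrite cardsU1 addnC; congr (_ + _)%N; rewrite !inE eqxx /= !andbF.
apply: subset_leq_card; rewrite subUset sXY andbT sub1set inE f1E.
exact: f1U.
Qed.

Let c_full i : (c i <= a)%N.
Proof.
rewrite ha /c.
have -> : (#|EH| - 2 = #|EH :\ f0 :\ f1|)%N.
  rewrite (cardsD1 f0 EH) f0E (cardsD1 f1 (EH :\ f0)) !inE f1E eq_sym f01 /=.
  by rewrite addnA addKn.
apply: subset_leq_card; apply/fintype.subsetP => h; rewrite !inE.
by case/and4P=> -> -> -> _.
Qed.

Let c_small i : (#|U i| <= 1)%N -> (c i + phi i = 0)%N.
Proof.
move=> Ui; apply/eqP; rewrite -leqn0; apply: leq_trans (c_phi i) _.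
rewrite leqn0 cards_eq0 -subset0; apply/fintype.subsetP => h.
by rewrite inE => /andP[/card_h + /subset_leq_card]; rewrite inE; lia.
Qed.

(** Here [U i] is not the whole vertex set, so [bal] applies once it has three vertices, and
    [#|U i| - 2 <= #|Sl i|]. Smaller sets span at most one edge, paid for by [ba]; when [Sl i] is
    empty, nothing besides [f0] fits. *)
Let level_open i : ~~ (f0 \subset U i) || (#|Sl i| != b) ->
  (b * c i + b * phi i <= a * #|Sl i|)%N.
Proof.
move=> op; rewrite -mulnDr.
have cU := card_U i; have cle := c_phi i; have Slb := Sl_le i.
have Uf : (#|U i :&: f0| <= 2)%N by rewrite -card_f0 subset_leq_card // subsetIr.
have Uf2 : ~~ (f0 \subset U i) -> (#|U i :&: f0| <= 1)%N.
  apply: contraR; rewrite -ltnNge => h2.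
  have /eqP <- : U i :&: f0 == f0 by rewrite eqEcard subsetIr card_f0.
  exact: subsetIl.
have [k2|k2] := leqP k 2.
  have b0 : b = 0%N by rewrite hb; apply/eqP; rewrite subn_eq0.
  by rewrite b0 mul0n leq0n.
have Uk : (#|U i| < k)%N.
  case: (boolP (f0 \subset U i)) op => [_ /= /eqP|/Uf2 + _].
    move: cU Slb Uf; move: #|U i| #|Sl i| #|U i :&: f0| => x y z; clear -k2 hb; lia.
  move: cU Slb Uf; move: #|U i| #|Sl i| #|U i :&: f0| => x y z; clear -k2 hb; lia.
have [S0|S0] := posnP #|Sl i|.
  suff -> : (c i + phi i = 0)%N by rewrite muln0.
  case: (boolP (f0 \subset U i)) => [fU|/Uf2 h1]; last by apply: c_small; rewrite cU S0.
  have Uf0 : U i = f0.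
    by apply/eqP; rewrite eq_sym eqEcard fU card_f0 cU S0.
  apply/eqP; rewrite addn_eq0 /c /phi Uf0; apply/andP; split.
    rewrite cards_eq0 -subset0; apply/fintype.subsetP => h.
    rewrite !inE => /and4P[hE /negP hf _ hs]; case: hf.
    by rewrite eqEcard hs card_f0 (card_h hE).
  rewrite eqb0; apply: contra f01 => hs.
  by rewrite eq_sym eqEcard hs card_f0 (card_h f1E).
have [U3|U3] := leqP 3 #|U i|.
  have /bal h : (3 <= #|U i| < k)%N by rewrite U3.
  apply: (@leq_trans (a * (#|U i| - 2))%N).
    apply: leq_trans h; rewrite leq_mul2l; apply/orP; right.
    by apply: leq_trans cle (leqnSn _).
  by rewrite leq_mul2l leq_subLR cU addnC leq_add2r Uf orbT.
have e1 : (c i + phi i <= 1)%N.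
  apply: leq_trans cle _; rewrite /eIn.
  apply: (@leq_trans #|[set U i]|); last by rewrite cards1.
  apply: subset_leq_card; apply/fintype.subsetP => h; rewrite !inE => /andP[hE hs].
  by rewrite eqEcard hs (card_h hE).
apply: (@leq_trans (b * 1)); first by rewrite leq_mul2l e1 orbT.
by rewrite muln1; apply: leq_trans ba _; rewrite leq_pmulr.
Qed.

Let level_full i : #|Sl i| = b -> (b * c i <= a * #|Sl i|)%N.
Proof. by move=> ->; rewrite mulnC leq_mul2r c_full orbT. Qed.

Let level_any i : (b * c i + b * phi i <= a * #|Sl i| + b)%N.
Proof.
have [e|ne] := eqVneq #|Sl i| b.
  by apply: leq_add; [apply: level_full|case: (phi i); rewrite ?muln1 ?muln0].
by apply: leq_trans (level_open _) (leq_addr _ _); rewrite ne orbT.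
Qed.

Let f0_next (i j : 'I_L) : j = i.+1 :> nat -> (f0 \subset U j) = phi i.
Proof.
move=> ji; have [h01 _ h0 h1] := uniq4P uniq4.
have eqs (i' : 'I_L) (h : {set 'I_k}) : (h \subset U i') =
    (key u0 u1 w0 w1 i' @: h \subset [set y | match y with inl _ => true | inr t => t \in S end]).
  apply/fintype.subsetP/fintype.subsetP => hs.
    by move=> y /imsetP[x xh ->]; have := hs x xh; rewrite !inE.
  move=> x xh; have := hs _ (imset_f (key u0 u1 w0 w1 i') xh).
  by rewrite !inE.
by rewrite /phi !eqs (key_succ uniq4 ji).
Qed.

(* A level whose f0 is present but which is not full has slack [b], which pays
   for the edge f1 that the next level gets for free. *)
Let chain_prefix m : (m < L)%N ->
  (forall j, (j <= m)%N -> #|Sl (inord j)| = b) \/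
  (b * (\sum_(j < m.+1) c (inord j)) + b * phi (inord m)
     <= a * \sum_(j < m.+1) #|Sl (inord j)|)%N.
Proof.
elim: m => [|m IH] mL.
  have [e|ne] := eqVneq #|Sl (inord 0)| b.
    by left=> j; rewrite leqn0 => /eqP ->.
  by right; rewrite !big_ord1; apply: level_open; rewrite ne orbT.
have mL' := ltnW mL.
have nx : (f0 \subset U (inord m.+1)) = phi (inord m) by apply: f0_next; rewrite !inordK.
rewrite !(big_ord_recr m.+1) /=.
have [full|part] := IH mL'.
  have [e|ne] := eqVneq #|Sl (inord m.+1)| b.
    by left=> j; rewrite leq_eqVlt => /predU1P[->//|]; rewrite ltnS; apply: full.
  right; have h : (b * c (inord m.+1) + b * phi (inord m.+1) <= a * #|Sl (inord m.+1)|)%N.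
    by apply: level_open; rewrite ne orbT.
  rewrite !mulnDr -addnA; apply: leq_add => //.
  rewrite !big_distrr /=; apply: leq_sum => j _; apply: level_full; apply: full.
  by rewrite -ltnS.
right; case: (boolP (phi (inord m))) => ph.
  have aux (x y z t u : nat) : (x + b <= t -> y + z <= u + b -> x + y + z <= t + u)%N.
    by clear; lia.
  rewrite !mulnDr; apply: aux (level_any _).
  by move: part; rewrite ph muln1.
have : (b * c (inord m.+1) + b * phi (inord m.+1) <= a * #|Sl (inord m.+1)|)%N.
  by apply: level_open; rewrite nx ph.
by move: part; rewrite (negPf ph) muln0 addn0 !mulnDr -addnA; apply: leq_add.
Qed.

(** The count is a sum over levels, with [phi ord_max] for the single [f1] kept in the last copy.
    The second alternative arises only when every level is full, and the surplus is then that one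
    edge. *)
Lemma chain_spanned : let e := spanned (chain_edges EH u0 u1 w0 w1 L')
    (@chain_supp k u0 u1 w0 w1 L') S in
  (b * e <= a * #|S|)%N \/ (L * b <= #|S|)%N /\ (e <= L * a + 1)%N.
Proof.
move=> e.
have -> : e = (\sum_i c i + phi ord_max)%N.
  rewrite /e /spanned card_pairs /=.
  have lvl i : (#|[set h | (i, h) \in [set ih in chain_edges EH u0 u1 w0 w1 L' |
      chain_supp u0 u1 w0 w1 ih \subset S]]| = c i + ((i == ord_max) && phi i))%N.
    have sup h : (chain_supp u0 u1 w0 w1 (i, h) \subset S) = (h \subset U i).
      apply/fintype.subsetP/fintype.subsetP => hs.
        move=> x xh; rewrite inE; case ek : (key _ _ _ _ _ _) => [//|t].
        by apply: hs; rewrite inE -ek imset_f.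
      move=> t; rewrite inE => /imsetP[x xh et].
      by have := hs x xh; rewrite inE -et.
    rewrite /c /phi; set X := [set h in EH | _].
    have -> : [set h | (i, h) \in [set ih in chain_edges EH u0 u1 w0 w1 L' |
      chain_supp u0 u1 w0 w1 ih \subset S]] =
      if (i == ord_max) && (f1 \subset U i) then f1 |: X else X.
      apply/setP => h; rewrite !inE sup /=.
      case: (boolP ((i == ord_max) && (f1 \subset U i))) => [/andP[im f1U]|nim].
        rewrite !inE im orbT andbT; have [->|hf] := eqVneq h f1.
          by rewrite f1E f1U eq_sym f01.
        by rewrite /= andbA.
      rewrite !inE; have [->|hf] := eqVneq h f1; last by rewrite /= andbT andbA.
      rewrite ?eqxx /= !andbF; apply: contraNF nim => /andP[/and3P[_ _ im] fu].
      by apply/andP; split.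
    case: ifP => _; last by rewrite addn0.
    by rewrite cardsU1 addnC; congr (_ + _)%N; rewrite !inE eqxx /= !andbF.
  rewrite (eq_bigr _ (fun i _ => lvl i)) big_split /=; congr (_ + _)%N.
  by rewrite (bigD1 ord_max) //= eqxx big1 ?addn0 // => i /negPf ->.
have sS : (\sum_i #|Sl i| <= #|S|)%N.
  rewrite card_pairs; apply: leq_sum => i _; apply: subset_leq_card.
  by apply/fintype.subsetP => x; rewrite !inE => /andP[].
have ro (F : 'I_L -> nat) : (\sum_i F i = \sum_(j < L) F (inord j))%N.
  by apply: eq_bigr => i _; rewrite inord_val.
have -> : ord_max = inord L' :> 'I_L by apply: val_inj; rewrite /= inordK.
have [full|part] := chain_prefix (ltnSn L').
  right; split.
    apply: leq_trans sS; rewrite (eq_bigr (fun=> b)) ?sum_nat_const ?card_ord //.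
    by move=> i _; have := full i; rewrite inord_val -ltnS ltn_ord => /(_ isT).
  apply: leq_add; last by case: (phi _).
  apply: (@leq_trans (\sum_(i < L) a)%N); last by rewrite sum_nat_const card_ord.
  by apply: leq_sum => i _; apply: c_full.
left; rewrite mulnDr ro; apply: leq_trans part _.
by rewrite leq_mul2l -(ro (fun i => #|Sl i|)) sS orbT.
Qed.

End ChainCount.


(** * Upper bound on p_c *)

Section UpperFinite.
Variables (R : realType) (p : R) (k : nat) (EH : {set {set 'I_k}}) (u0 u1 w0 w1 : 'I_k).
Hypothesis p01 : 0 < p <= 1.
Hypothesis EHpairs : EH \subset pairs 'I_k.
Hypothesis f0E : [set u0; u1] \in EH.
Hypothesis uniq4 : uniq [:: u0; u1; w0; w1].
Variables (L' M N n : nat).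
Let L := L'.+1.
Let T := ('I_L * 'I_k)%type.
Hypothesis N0 : (0 < N)%N.
Hypothesis room : (M * (L * k) * N + 2 <= n)%N.

Definition chain_sum : R := \sum_(S : {set T} | S != set0)
  (N%:R ^+ #|S| * p ^+ spanned (chain_edges EH u0 u1 w0 w1 L') (@chain_supp k u0 u1 w0 w1 L') S)^-1.

(** The vertices other than [r0] and [r1] provide [M] disjoint blocks, each with [N] positions per
    coordinate. Chains in different blocks use disjoint sets of potential edges, so their failures
    are independent. *)
Lemma infected_prob (r0 r1 : 'I_n) : r0 != r1 ->
  gnp_prob p (fun G => ~ infected EH G [set r0; r1]) <= chain_sum ^+ M.
Proof.
move=> r01; have p01' : 0 <= p <= 1 by move: p01 => /andP[/ltW -> ->].
(* [room] keeps the index within the list, so the default [r0] of [nth] is never returned. *)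
pose slot (u : 'I_M * T * 'I_N) : 'I_n := nth r0 (enum (~: [set r0; r1])) (enum_rank u).
have slot_lt (u : 'I_M * T * 'I_N) : (enum_rank u < size (enum (~: [set r0; r1])))%N.
  apply: leq_trans (ltn_ord _) _.
  have cC : (#|~: [set r0; r1]| + 2 = n)%N.
    by have := cardsC [set r0; r1]; rewrite cards2 r01 card_ord addnC.
  have cT : #|{: 'I_M * T * 'I_N}| = (M * (L * k) * N)%N.
    by rewrite card_prod card_prod card_prod !card_ord.
  by rewrite cT -(leq_add2r 2) -cardE cC.
have slot_inj : injective slot.
  move=> u v /eqP; rewrite nth_uniq ?slot_lt ?enum_uniq // => /eqP h.
  exact/enum_rank_inj/val_inj.
have slot_r u : (slot u != r0) && (slot u != r1).
  have : slot u \in ~: [set r0; r1] by rewrite -mem_enum mem_nth // slot_lt.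
  by rewrite !inE negb_or.
pose pos (m : 'I_M) (t : T) (c : 'I_N) : 'I_n := slot (m, t, c).
have pos_r m t c : (pos m t c != r0) && (pos m t c != r1) by apply: slot_r.
have pos_inj m t c t' c' : pos m t c = pos m t' c' -> t = t' /\ c = c'.
  by move=> /slot_inj[-> ->].
pose ce m := @chain_edge k u0 u1 w0 w1 L' n N r0 r1 (pos m).
pose I := chain_edges EH u0 u1 w0 w1 L'.
pose X (m : 'I_M) (E : {set {set 'I_n}}) : R := (~~ [exists f, placed I (ce m) f \subset E])%:R.
pose Dm (m : 'I_M) := (\bigcup_(f : {ffun T -> 'I_N}) placed I (ce m) f)%SET.
have DmP m (e : {set 'I_n}) : e \in Dm m -> exists f, exists2 ih, ih \in I & e = ce m f ih.
  by case/bigcupP => f _ /imsetP[ih ihI ->]; exists f, ih.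
apply: (@le_trans _ _ (Ex p (pairs 'I_n) (fun E => \prod_m X m E))).
  apply: gnp_markov => // E sE; first by apply: prodr_ge0 => m _; apply: ler0n.
  move=> ninf; rewrite big1 // => m _; rewrite /X; case: existsP => //= -[f fE].
  by case: ninf; apply: (chain_infects EHpairs f0E uniq4 r01 (pos_r m) _ fE) => t c t' c' /pos_inj.
rewrite (@Ex_indep_prod _ _ _ _ _ Dm) ?index_enum_uniq //.
- rewrite -[M in _ ^+ M]card_ord -prodr_const; apply: ler_prod => m _.
  apply/andP; split; first by apply: Ex_ge0 => // E _; apply: ler0n.
  rewrite /chain_sum /X; apply: second_moment => //.
  + by move=> f i iI; apply: (chain_edge_pairs EHpairs uniq4 r01 (pos_r m) _ _ iI) => t c t' c' /pos_inj.
  + by move=> f g i j iI jI; apply: (chain_edge_inj EHpairs uniq4 r01 (pos_r m) _ iI jI) => t c t' c' /pos_inj.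
  + by move=> i; apply: chain_supp_neq0.
- move=> m; apply/fintype.subsetP => e /DmP[f [ih ihI ->]].
  by apply: (chain_edge_pairs EHpairs uniq4 r01 (pos_r m) _ _ ihI) => t c t' c' /pos_inj.
(* An edge of a chain has a vertex other than [r0] and [r1], and that vertex determines the
   block. *)
- move=> m m' mm'; rewrite -setI_eq0 -subset0; apply/fintype.subsetP => e.
  rewrite inE => /andP[/DmP[f [ih ihI ->]] /DmP[g [jh _]]].
  move=> e_eq; have : ih \in I by []; rewrite inE => /and3P[hE hf _].
  have [x xh xu] := edge_notf0 EHpairs uniq4 hE hf.
  have : pos m (ih.1, x) (f (ih.1, x)) \in ce m f ih.
    apply/imsetP; exists (key u0 u1 w0 w1 ih.1 x); first exact: imset_f.
    by rewrite key_id.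
  rewrite e_eq => /imsetP[[b|t] _] /= h.
    have /andP[/negP h0 /negP h1] := pos_r m (ih.1, x) (f (ih.1, x)).
    by case: b h => h; [case: h1|case: h0]; rewrite h.
  by move/slot_inj: h => [em _ _]; rewrite em eqxx in mm'.
- move=> m E; rewrite /X; congr ((~~ _)%:R); apply: eq_existsb => f.
  rewrite subsetI andbC; case: (boolP (_ \subset Dm m)) => //.
  by case/negP; apply: bigcup_sup.
Qed.

Lemma percolates_prob :
  1 - gnp_prob p (percolates EH (n := n)) <= #|pairs 'I_n|%:R * chain_sum ^+ M.
Proof.
have p01' : 0 <= p <= 1 by move: p01 => /andP[/ltW -> ->].
rewrite -gnpC.
apply: le_trans (gnp_union p01' (B := mem (pairs 'I_n))
   (P := fun e G => ~ infected EH G e) _) _.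
  move=> E sE nperc; apply: contrapT => h; apply: nperc => e; split.
    exact: infected_pairs.
  move=> eP; apply: contrapT => ninf; apply: h; by exists e.
rewrite mulr_natl -sumr_const; apply: ler_sum => e.
rewrite inE => eP; have /cards2P[r0 [r1 [r01 ->]]] : #|e| == 2%N by move: eP; rewrite inE.
exact: infected_prob.
Qed.

End UpperFinite.


Section UpperAsymptotic.
Variables (R : realType) (k : nat) (EH : {set {set 'I_k}}) (u0 u1 w0 w1 : 'I_k).
Hypothesis EHpairs : EH \subset pairs 'I_k.
Hypothesis f0E : [set u0; u1] \in EH.
Hypothesis f1E : [set w0; w1] \in EH.
Hypothesis uniq4 : uniq [:: u0; u1; w0; w1].
Variables (a b : nat).
Hypothesis ha : a = (#|EH| - 2)%N.
Hypothesis hb : b = (k - 2)%N.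
Hypothesis b0 : (0 < b)%N.
Hypothesis ba : (b <= a)%N.
Hypothesis bal : forall S : {set 'I_k}, (3 <= #|S| < k)%N ->
  (b * (eIn EH S).+1 <= a * (#|S| - 2))%N.
Let kappa : R := b%:R / a%:R.

Let a0 : 0 < a%:R :> R.
Proof. by rewrite ltr0n (leq_trans b0 ba). Qed.

Let kappaE : kappa * a%:R = b%:R.
Proof. by rewrite /kappa divfK // lt0r_neq0. Qed.

Let kappa_gt0 : 0 < kappa.
Proof. by rewrite divr_gt0 // ltr0n. Qed.

(** Up to constants, [n] to this exponent is the inverse of a term of [chain_sum] at
    [p = n^(eps - kappa)]. In the first case of [chain_spanned], [#|S| >= kappa * e] leaves a gain
    [eps * e]; in the second, the surplus edge costs at most [kappa], which [L'.+1] copies make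
    up. *)
Lemma chain_exponent (L' : nat) (eps : R) (S : {set 'I_L'.+1 * 'I_k}) :
  0 < eps < kappa -> eps <= 1 -> kappa + eps <= eps * (L'.+1%:R * a%:R) -> S != set0 ->
  eps <= #|S|%:R + (eps - kappa) *
    (spanned (chain_edges EH u0 u1 w0 w1 L') (@chain_supp k u0 u1 w0 w1 L') S)%:R.
Proof.
move=> /andP[e0 ek] e1 eL S0.
have := chain_spanned EHpairs f0E f1E uniq4 ha hb ba bal S.
set e := spanned _ _ _ => -[h|[h1 h2]].
  have [->|en0] := posnP e.
    rewrite mulr0 addr0; apply: le_trans e1 _.
    by rewrite -[X in X <= _]/(1%:R) ler_nat card_gt0.
  have h' : kappa * e%:R <= #|S|%:R.
    have : (b * e)%:R <= (a * #|S|)%:R :> R by rewrite ler_nat.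
    rewrite !natrM -kappaE => h3; rewrite -(ler_pM2l a0); apply: le_trans h3.
    by rewrite mulrA [a%:R * _]mulrC.
  have : eps * 1 <= eps * e%:R by rewrite ler_wpM2l ?(ltW e0) // ler1n.
  rewrite mulrBl; lra.
have h1' : (L'.+1)%:R * (kappa * a%:R) <= #|S|%:R by rewrite kappaE -natrM ler_nat.
have h2' : e%:R <= (L'.+1)%:R * a%:R + 1 :> R.
  by rewrite -natrM -[X in _ + X]/(1%:R) -natrD ler_nat.
have h3 : (eps - kappa) * ((L'.+1)%:R * a%:R + 1) <= (eps - kappa) * e%:R.
  by apply: ler_wnM2l => //; rewrite subr_le0 ltW.
move: h1' h3 eL; set l := (L'.+1)%:R; move: (e%:R) => E.
rewrite mulrDr mulr1 mulrBl mulrBl mulrCA; lra.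
Qed.

(** There is one term for each of at most [2 ^ (L'.+1 * k)] coordinate sets; [c0] measures the loss
    from having [N] positions instead of [n]. *)
Lemma chain_sum_le (L' N n : nat) (c0 eps : R) :
  0 < eps < kappa -> eps <= 1 -> kappa + eps <= eps * (L'.+1%:R * a%:R) ->
  (0 < n)%N -> 1 <= c0 -> n%:R <= c0 * N%:R ->
  chain_sum (n%:R `^ (eps - kappa)) EH u0 u1 w0 w1 L' N
    <= (2 * c0) ^+ (L'.+1 * k) * n%:R `^ (- eps).
Proof.
move=> he e1 eL n0 c1 nN; have y0 : 0 < n%:R :> R by rewrite ltr0n.
have y1 : 1 <= n%:R :> R by rewrite ler1n.
have c00 : 0 < c0 by apply: lt_le_trans c1.
have ge0 : 0 <= c0 ^+ (L'.+1 * k) * n%:R `^ (- eps).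
  by rewrite mulr_ge0 ?powR_ge0 // exprn_ge0 // ltW.
rewrite exprMn -mulrA /chain_sum.
apply: (@le_trans _ _ (\sum_(S : {set 'I_L'.+1 * 'I_k}) c0 ^+ (L'.+1 * k) * n%:R `^ (- eps))).
  rewrite big_mkcond /=; apply: ler_sum => S _; case: ifP => // S0.
  have hexp := chain_exponent he e1 eL S0.
  set e := spanned _ _ _ in hexp *.
  have s1 : (#|S| <= L'.+1 * k)%N.
    by apply: leq_trans (max_card _) _; rewrite card_prod !card_ord.
  have pe : (n%:R `^ (eps - kappa)) ^+ e = n%:R `^ ((eps - kappa) * e%:R) :> R.
    by rewrite powRrM powR_mulrn // powR_ge0.
  rewrite pe.
  apply: (@le_trans _ _ ((n%:R / c0) ^+ #|S| * n%:R `^ ((eps - kappa) * e%:R))^-1).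
    rewrite lef_pV2 ?posrE; last 2 first.
    - by rewrite mulr_gt0 ?powR_gt0 // exprn_gt0 //; move: nN; rewrite mulrC -ler_pdivrMr //; apply: lt_le_trans; rewrite divr_gt0.
    - by rewrite mulr_gt0 ?powR_gt0 // exprn_gt0 // divr_gt0.
    rewrite ler_wpM2r ?powR_ge0 // lerXn2r ?nnegrE ?ler0n ?divr_ge0 ?(ltW c00) //.
    by rewrite ler_pdivrMr // mulrC.
  rewrite expr_div_n mulrAC -(powR_mulrn _ (ltW y0)) -powRD; last by rewrite (lt0r_neq0 y0) implybT.
  rewrite invf_div; apply: ler_pM.
  - by rewrite exprn_ge0 // ltW.
  - by rewrite invr_ge0 powR_ge0.
  - by apply: ler_weXn2l.
  - by rewrite -powRN; apply: ler_powR => //; rewrite lerN2.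
rewrite sumr_const -[X in X <= _]mulr_natl ler_wpM2r // -natrX ler_nat.
by rewrite -[X in (X <= _)%N]cardsT -powersetT card_powerset cardsT card_prod !card_ord.
Qed.

Lemma p_c_le (p : R) (n : nat) : 0 < p <= 1 ->
  2^-1 <= gnp_prob p (percolates EH (n := n)) -> p_c R EH n <= p.
Proof.
move=> p01 hp; apply: ge_inf; first by exists 0 => x [/andP[/ltW]].
by split.
Qed.

Lemma p_c_upper (eps : R) : 0 < eps < kappa -> eps <= 1 ->
  exists n0, forall n, (n0 <= n)%N -> p_c R EH n <= n%:R `^ (eps - kappa).
Proof.
move=> he e1; have /andP[e0 ek] := he.
have [L' hL] : exists L' : nat, kappa + eps <= eps * (L'.+1%:R * a%:R).
  have x0 : 0 <= (kappa + eps) / (eps * a%:R) by apply: divr_ge0; apply: ltW; [apply: addr_gt0|apply: mulr_gt0].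
  exists (Num.bound ((kappa + eps) / (eps * a%:R))).
  have := ltW (archi_boundP x0); rewrite ler_pdivrMr ?mulr_gt0 // => h; apply: le_trans h _.
  rewrite -natr1 [X in _ <= eps * X]mulrDl mul1r [X in _ <= X]mulrDr mulrCA lerDl.
  by rewrite mulr_ge0 // ltW.
(* The blocks gain a factor [n^(-3)], so that after the union bound over at most [n ^ 2] pairs a
   factor [1 / n] remains. *)
have [M hM] : exists M : nat, 3 <= eps * M%:R.
  have x0 : 0 <= 3 / eps by rewrite divr_ge0 ?ltW.
  exists (Num.bound (3 / eps)).
  by have := ltW (archi_boundP x0); rewrite ler_pdivrMr // mulrC.
have M0 : (0 < M)%N.
  by rewrite lt0n; apply: contraTneq hM => ->; rewrite mulr0 -ltNge.
have k0 : (0 < k)%N by move: b0; rewrite hb subn_gt0; apply: leq_ltn_trans.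
have [m mE] : exists m, m = (M * (L'.+1 * k))%N by exists (M * (L'.+1 * k))%N.
have m0 : (0 < m)%N by rewrite mE !muln_gt0 M0 k0.
(* The factor 4 absorbs both the floor in [N] and the two vertices set aside. *)
pose c0 : R := (4 * m)%:R.
have c1 : 1 <= c0 by rewrite ler1n muln_gt0.
pose K : R := ((2 * c0) ^+ (L'.+1 * k)) ^+ M.
have K0 : 0 <= 2 * K by rewrite mulr_ge0 // !exprn_ge0 // mulr_ge0 // (le_trans ler01 c1).
exists (m + 2 + Num.bound (2 * K))%N => n hn.
have nm : (m + 2 <= n)%N by apply: leq_trans hn; apply: leq_addr.
have n0 : (0 < n)%N by apply: leq_trans nm; rewrite addn2.
pose N := ((n - 2) %/ m)%N.
have N0 : (0 < N)%N by rewrite divn_gt0 //; move: nm; clear; move: m; lia.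
have hNm : (N * m <= n - 2)%N by apply: leq_trunc_div.
have hNm2 : (n - 2 < N.+1 * m)%N by apply: ltn_ceil.
have y1 : 1 <= n%:R :> R by rewrite ler1n.
have y0 : 0 < n%:R :> R by rewrite ltr0n.
have p01 : 0 < (n%:R : R) `^ (eps - kappa) <= 1.
  rewrite powR_gt0 //= -[X in _ <= X](powRr0 n%:R); apply: ler_powR => //.
  by rewrite subr_le0 ltW.
apply: p_c_le => //.
have nN : (n <= 4 * m * N)%N by move: hNm2 nm m0 N0; rewrite mulSn; clear; nia.
have room : (M * (L'.+1 * k) * N + 2 <= n)%N.
  by rewrite -mE mulnC; move: hNm nm; clear; lia.
have := percolates_prob p01 EHpairs f0E uniq4 N0 room.
set P := gnp_prob _ _ => hP.
suff : #|pairs 'I_n|%:R * chain_sum (n%:R `^ (eps - kappa) : R) EH u0 u1 w0 w1 L' N ^+ M <= 2^-1.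
  by move: hP; lra.
apply: (@le_trans _ _ (n%:R ^+ 2 * ((2 * c0) ^+ (L'.+1 * k) * n%:R `^ (- eps)) ^+ M)).
  apply: ler_pM; rewrite ?ler0n ?exprn_ge0 //.
  - apply: sumr_ge0 => S _; rewrite invr_ge0 mulr_ge0 ?exprn_ge0 ?ler0n ?powR_ge0 //.
  - rewrite -natrX ler_nat.
    by rewrite card_draws card_ord bin2; clear; nia.
  - apply: lerXn2r; rewrite ?nnegrE.
    + apply: sumr_ge0 => S _; rewrite invr_ge0 mulr_ge0 ?exprn_ge0 ?ler0n ?powR_ge0 //.
    + by rewrite mulr_ge0 ?powR_ge0 // exprn_ge0 // mulr_ge0 // (le_trans ler01 c1).
    + by apply: (chain_sum_le (c0 := c0)) => //; rewrite -natrM ler_nat.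
rewrite exprMn -/K mulrCA.
have -> : n%:R ^+ 2 * (n%:R `^ (- eps)) ^+ M = n%:R `^ (2 - eps * M%:R) :> R.
  rewrite -[X in X * _]powR_mulrn ?ler0n // -[X in _ * X]powR_mulrn ?powR_ge0 // -powRrM -powRD.
    by rewrite mulNr.
  by rewrite (lt0r_neq0 y0) implybT.
apply: (@le_trans _ _ (K * n%:R^-1)).
  rewrite ler_wpM2l; first by []; last by rewrite -powR_inv1 ?ler0n //; apply: ler_powR => //; lra.
  by move: K0; rewrite pmulr_rge0.
rewrite ler_pdivrMr // mulrC ler_pdivlMr // mulrC.
apply: ltW; apply: lt_le_trans (archi_boundP K0) _.
by rewrite ler_nat; apply: leq_trans hn; apply: leq_addl.
Qed.

End UpperAsymptotic.


(** * Lower bound on p_c *)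

Lemma card_sets_of_size (T : finType) (s : nat) : (#|[set X : {set T} | #|X| == s]| <= #|T| ^ s)%N.
Proof.
rewrite card_draws; apply: (@leq_trans (#|T| ^_ s)%N).
  by rewrite -bin_ffact leq_pmulr ?fact_gt0.
elim: s #|T| => [|s IH] m; first by rewrite ffactn0.
rewrite ffactnSr expnSr; apply: leq_mul (IH m) _; exact: leq_subr.
Qed.

Lemma card_supersets_of_size (T : finType) (e : {set T}) (s : nat) :
  (#|[set X : {set T} | (e \subset X) && (#|X| == s)]| <= #|T| ^ (s - #|e|))%N.
Proof.
apply: leq_trans (card_sets_of_size T (s - #|e|)).
set B := [set X | _]; rewrite -(@card_in_imset _ _ (fun X => X :\: e) B).
  apply: subset_leq_card; apply/fintype.subsetP => Y /imsetP[X].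
  by rewrite !inE => /andP[eX /eqP <-] ->; rewrite cardsD (setIidPr eX).
move=> X Y; rewrite !inE => /andP[eX _] /andP[eY _] eq.
by rewrite -(setID X e) -(setID Y e) eq (setIidPr eX) (setIidPr eY).
Qed.

Section Lower.
Variables (R : realType) (k : nat) (EH : {set {set 'I_k}}).
Hypothesis EHpairs : EH \subset pairs 'I_k.
Variables (a b : nat).
Hypothesis ha : a = (#|EH| - 2)%N.
Hypothesis hb : b = (k - 2)%N.
Hypothesis b0 : (0 < b)%N.
Hypothesis ba : (b <= a)%N.
Hypothesis bal : forall S : {set 'I_k}, (2 <= #|S| < k)%N ->
  (b * eIn EH S <= a * (#|S| - 2) + b)%N.
Let kappa : R := b%:R / a%:R.

Let aR : 0 < a%:R :> R.
Proof. by rewrite ltr0n (leq_trans b0 ba). Qed.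
Let bR : 0 < b%:R :> R.
Proof. by rewrite ltr0n. Qed.
Let kappa_gt0 : 0 < kappa.
Proof. by rewrite divr_gt0. Qed.
Let kappa_le1 : kappa <= 1.
Proof. by rewrite ler_pdivrMr // mul1r ler_nat. Qed.

Definition dense (n : nat) (G : {set {set 'I_n}}) (X : {set 'I_n}) : Prop :=
  (a * (#|X| - 2) + b <= b * eIn G X)%N.

(** Number of edges forced on a dense set of size [s], namely [lambda * (s - 2) + 1], as [kappa] is
    [1 / lambda]. *)
Definition dense_exp (s : nat) : R := kappa^-1 * (s - 2)%:R + 1.

Lemma dense_prob (p : R) (n : nat) (X : {set 'I_n}) : 0 < p <= 1 ->
  gnp_prob p (fun G => dense G X) <= 2 ^+ (#|X| ^ 2) * p `^ dense_exp #|X|.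
Proof.
move=> p01; have p01' : 0 <= p <= 1 by move: p01 => /andP[/ltW -> ->].
have /andP[p0 p1] := p01.
pose PX : {set {set 'I_n}} := [set e in pairs 'I_n | e \subset X].
pose B (F : {set {set 'I_n}}) := (F \in powerset PX) && (a * (#|X| - 2) + b <= b * #|F|)%N.
apply: le_trans (gnp_union p01' (B := B) (P := fun F G => F \subset G) _) _.
  move=> E sE dE; exists [set e in E | e \subset X].
    apply/andP; split => //; rewrite powersetE; apply/fintype.subsetP => e.
    by rewrite inE => /andP[/(fintype.subsetP sE) eP eX]; rewrite inE eP.
  by apply/fintype.subsetP => e; rewrite inE => /andP[].
apply: (@le_trans _ _ (\sum_(F in powerset PX) p `^ dense_exp #|X|)).
  rewrite [X in _ <= X]big_mkcond [X in X <= _]big_mkcond; apply: ler_sum => F _.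
  rewrite /B; case: (boolP (F \in powerset PX)) => //= FP.
  case: ifP => hF; last exact: powR_ge0.
  rewrite gnp_probE (@eq_Ex _ _ _ _ _ (fun E => (F \subset E)%:R)); last first.
    by move=> E _; rewrite asboolb.
  rewrite Ex_sub; last first.
    move: FP; rewrite powersetE => /fintype.subsetP FP.
    by apply/fintype.subsetP => e /FP; rewrite inE => /andP[].
  rewrite -powR_mulrn ?(ltW p0) //; apply: ger_powR => //.
  have : (a * (#|X| - 2) + b)%:R <= (b * #|F|)%:R :> R by rewrite ler_nat.
  rewrite /dense_exp /kappa invf_div natrD !natrM => h.
  by rewrite -(ler_pM2l bR); apply: le_trans h; rewrite mulrDr mulr1 mulrA mulrCA divff ?mulr1 // lt0r_neq0.
rewrite sumr_const -[X in X <= _]mulr_natl ler_wpM2r ?powR_ge0 //.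
rewrite card_powerset -natrX ler_nat leq_exp2l //.
have -> : #|PX| = 'C(#|X|, 2).
  by rewrite -cards_draws; apply: eq_card => e; rewrite !inE andbC.
by rewrite bin2 -divn2 (leq_trans (leq_div _ _)) // -mulnn leq_mul // leq_pred.
Qed.

(** First moment bound, size by size: [d] is the number of prescribed vertices, [C.+1] bounds the
    number of sizes, and [t] bounds the exponent of [n] for each of them. *)
Lemma dense_family_prob (p : R) (n C d : nat) (B : pred {set 'I_n}) (eps t : R) :
  (0 < n)%N -> 0 < p <= 1 -> p <= n%:R `^ (- (kappa + eps)) ->
  (forall s, #|[set X : {set 'I_n} | B X && (#|X| == s)]| <= n ^ (s - d))%N ->
  (forall X, B X -> (2 <= #|X| <= C)%N) ->
  (forall X, B X -> (#|X| - d)%:R - (kappa + eps) * dense_exp #|X| <= t) ->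
  gnp_prob p (fun G => exists2 X, B X & dense G X) <= C.+1%:R * 2 ^+ (C ^ 2) * n%:R `^ t.
Proof.
move=> n0 p01 ple hcard hC ht; have p01' : 0 <= p <= 1 by move: p01 => /andP[/ltW -> ->].
have y1 : 1 <= n%:R :> R by rewrite ler1n.
have y0 : 0 < n%:R :> R by rewrite ltr0n.
apply: le_trans (gnp_union p01' (B := B) (P := fun X G => dense G X) _) _ => //.
rewrite (partition_big (fun X : {set 'I_n} => inord #|X| : 'I_C.+1) predT) //=.
have -> : C.+1%:R = #|'I_C.+1|%:R :> R by rewrite card_ord.
rewrite -mulrA [X in _ <= X]mulr_natl -sumr_const.
apply: ler_sum => s _.
have sz X : B X && (inord #|X| == s) -> #|X| = s :> nat.
  by case/andP => /hC/andP[_ XC] /eqP <-; rewrite inordK.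
apply: (@le_trans _ _ (\sum_(X : {set 'I_n} | B X && (inord #|X| == s))
   2 ^+ (C ^ 2) * n%:R `^ (- (kappa + eps) * dense_exp s))).
  apply: ler_sum => X BX; apply: le_trans (dense_prob _ p01) _.
  have XC : (#|X| <= C)%N by case/andP: BX => /hC/andP[].
  apply: ler_pM; rewrite ?exprn_ge0 ?powR_ge0 //.
    by apply: ler_weXn2l; rewrite ?ler1n // leq_exp2r.
  rewrite (sz X BX) powRrM; apply: ge0_ler_powR; rewrite ?nnegrE ?powR_ge0 //.
    by rewrite /dense_exp addr_ge0 // mulr_ge0 // invr_ge0 ltW.
  by have /andP[/ltW] := p01.
rewrite sumr_const -[X in X <= _]mulr_natl mulrCA ler_wpM2l ?exprn_ge0 //.
case: (pickP (fun X : {set 'I_n} => B X && (inord #|X| == s))) => [X0 B0|none]; last first.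
  by rewrite eq_card0 ?mul0r ?powR_ge0.
have B0' : B X0 by case/andP: B0.
apply: (@le_trans _ _ (n%:R `^ (s - d)%:R * n%:R `^ (- (kappa + eps) * dense_exp s))).
  rewrite ler_wpM2r ?powR_ge0 // powR_mulrn ?ler0n // -natrX ler_nat.
  apply: leq_trans (hcard s); rewrite -[X in (X <= _)%N]cardsE.
  apply: subset_leq_card; apply/fintype.subsetP => X; rewrite !inE => BX.
  by rewrite (sz X BX) eqxx andbT; case/andP: BX.
rewrite -powRD ?(lt0r_neq0 y0) ?implybT //; apply: ler_powR => //.
by have := ht X0 B0'; rewrite (sz X0 B0) mulNr.
Qed.

(** Without a dense set in the size window, the tight-set argument applies and yields a small dense
    set around [e0]. *)
Lemma percolates_cover (n L C : nat) (G : {set {set 'I_n}}) (e0 : {set 'I_n}) :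
  (2 <= k)%N -> (2 <= #|EH|)%N -> (2 <= L)%N -> C = (k + #|EH| * L)%N ->
  G \subset pairs 'I_n -> e0 \in pairs 'I_n -> percolates EH G ->
  (exists2 X : {set 'I_n}, (L < #|X| <= C)%N & dense G X) \/
  (exists2 X : {set 'I_n}, (e0 \subset X) && (2 <= #|X| <= L)%N & dense G X).
Proof.
move=> k2 e2 L2 CE sG e0P pG.
case: (pselect (exists2 X : {set 'I_n}, (L < #|X| <= C)%N & dense G X)) => h; first by left.
right; have CL : (2 * L <= C)%N by rewrite CE; nia.
have gap (X : {set 'I_n}) : (L < #|X| <= C)%N -> (b * eIn G X < a * (#|X| - 2) + b)%N.
  move=> hX; rewrite ltnNge; apply/negP => d; apply: h; by exists X.
have [X [eX X2 dX]] := percolates_dense sG L2 CL gap EHpairs k2 e2 ha hb CE bal pG e0P.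
by exists X; rewrite ?eX.
Qed.

Lemma p_c_lower (eps : R) : 0 < eps ->
  exists n0, forall n, (n0 <= n)%N -> n%:R `^ (- (kappa + eps)) <= p_c R EH n.
Proof.
move=> e0.
have k2 : (2 <= k)%N by move: b0; rewrite hb; lia.
have eH2 : (2 <= #|EH|)%N by move: b0 ba; rewrite ha; lia.
(* Large sets have no prescribed vertices, hence up to [n ^ s] positions rather than [n ^ (s - 2)];
   their edges must recover two powers of [n], and 3 does so with room. *)
have [L [L2 hL]] : exists L : nat, (2 <= L)%N /\ 3 <= eps * (kappa^-1 * (L - 2)%:R).
  have x0 : 0 <= 3 * kappa / eps by apply: divr_ge0; apply: ltW => //; apply: mulr_gt0.
  exists (Num.bound (3 * kappa / eps) + 2)%N; rewrite addnK leq_addl; split=> //.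
  have := ltW (archi_boundP x0); rewrite ler_pdivrMr // -ler_pdivlMr // => h.
  by rewrite mulrCA mulrC [eps * _]mulrC.
pose C := (k + #|EH| * L)%N.
pose K0 : R := C.+1%:R * 2 ^+ (C ^ 2).
have K00 : 0 < K0 by rewrite mulr_gt0 ?exprn_gt0 ?ltr0n.
(* Beyond [K] one has [K0 * n^(-kappa) < 1/4], so the two alternatives together stay below one
   half. *)
pose K : R := (4 * K0) `^ kappa^-1.
have Kge0 : 0 <= K by apply: powR_ge0.
exists (2 + Num.bound K)%N => n hn.
have n2 : (2 <= n)%N by apply: leq_trans hn; apply: leq_addr.
have n0 : (0 < n)%N by apply: leq_trans n2.
have nK : K < n%:R.
  by apply: lt_le_trans (archi_boundP Kge0) _; rewrite ler_nat; apply: leq_trans hn; apply: leq_addl.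
have y1 : 1 <= n%:R :> R by rewrite ler1n.
have y0 : 0 < n%:R :> R by rewrite ltr0n.
have small : K0 * n%:R `^ (- kappa) < 4^-1.
  rewrite powRN ltr_pdivrMr ?powR_gt0 // mulrC ltr_pdivlMr // mulrC.
  have -> : 4 * K0 = K `^ kappa.
    by rewrite /K -powRrM mulVf ?lt0r_neq0 // powRr1 // mulr_ge0 // ltW.
  by apply: gt0_ltr_powR => //; rewrite nnegrE ltW.
apply: lb_le_inf.
  (* The set defining [p_c] is nonempty: at [p = 1] the graph is complete. *)
  exists 1; split; first by apply/andP; split; [exact: ltr01|exact: lexx].
  have p01 : (0 <= (1 : R)) && ((1 : R) <= 1) by rewrite ler01 lexx.
  apply: le_trans (_ : 1 <= _); first by rewrite invf_le1 ?ler1n.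
  rewrite -[X in X <= _](expr1n _ #|pairs 'I_n|) -(@Ex_sub _ _ 1 (pairs 'I_n)) //.
  rewrite gnp_probE; apply: ler_Ex => // E sE; rewrite ler_nat.
  case: (boolP (pairs 'I_n \subset E)) => //= sE'.
  case: asboolP => // -[] e; split; first exact: infected_pairs.
  by move=> eP; exists 0%N; apply: (fintype.subsetP sE').
move=> p [p01 hp]; rewrite leNgt; apply/negP => /ltW ple.
have p01' : 0 <= p <= 1 by move: p01 => /andP[/ltW -> ->].
pose x0 : 'I_n := Ordinal n0; pose x1 : 'I_n := Ordinal n2.
pose e := [set x0; x1].
have ce : #|e| = 2%N by rewrite cards2.
have eP : e \in pairs 'I_n by rewrite inE ce.
pose B1 (X : {set 'I_n}) := (L < #|X| <= C)%N.
pose B2 (X : {set 'I_n}) := (e \subset X) && (2 <= #|X| <= L)%N.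
have LC : (L <= C)%N by rewrite /C; move: eH2; clear; nia.
have h1 : gnp_prob p (fun G => exists2 X, B1 X & dense G X) <= K0 * n%:R `^ (- kappa).
  apply: (dense_family_prob (d := 0) (eps := eps)) => //.
  - move=> s; rewrite subn0 -[n in (_ <= n ^ _)%N]card_ord.
    apply: leq_trans (card_sets_of_size _ s); apply: subset_leq_card.
    by apply/fintype.subsetP => X; rewrite !inE => /andP[].
  - by move=> X /andP[LX ->]; rewrite andbT; apply: leq_trans L2 (ltnW LX).
  - move=> X /andP[LX _]; rewrite subn0 /dense_exp.
    have sX : (#|X|)%:R = (#|X| - 2)%:R + 2 :> R.
      by rewrite -[X in _ + X]/(2%:R) -natrD subnK // (leq_trans L2) // ltnW.
    have LX' : (L - 2)%:R <= (#|X| - 2)%:R :> R by rewrite ler_nat leq_sub2r // ltnW.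
    rewrite sX; move: ((#|X| - 2)%:R) LX' => z LX'.
    have h3 : eps * (kappa^-1 * (L - 2)%:R) <= eps * (kappa^-1 * z).
      by rewrite !ler_wpM2l // ?invr_ge0 ltW.
    rewrite mulrDr mulr1 mulrDl mulrA divff ?lt0r_neq0 // mul1r.
    move: kappa_le1 hL h3 e0; lra.
have h2 : gnp_prob p (fun G => exists2 X, B2 X & dense G X) <= K0 * n%:R `^ (- kappa).
  apply: (dense_family_prob (d := 2) (eps := eps)) => //.
  - move=> s; have := card_supersets_of_size e s; rewrite ce card_ord.
    apply: leq_trans; apply: subset_leq_card.
    by apply/fintype.subsetP => X; rewrite !inE -andbA => /and3P[-> _ ->].
  - by move=> X /and3P[_ -> XL]; apply: leq_trans XL LC.
  - move=> X /and3P[_ X2 _]; rewrite /dense_exp; move: ((#|X| - 2)%:R) (ler0n R (#|X| - 2)) => z z0.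
    have h3 : 0 <= eps * (kappa^-1 * z) by rewrite !mulr_ge0 // ?invr_ge0 ltW.
    rewrite mulrDr mulr1 mulrDl mulrA divff ?lt0r_neq0 // mul1r.
    move: h3 e0; lra.
have h3 : gnp_prob p (percolates EH (n := n)) <=
    gnp_prob p (fun G => exists2 X, B1 X & dense G X) +
    gnp_prob p (fun G => exists2 X, B2 X & dense G X).
  pose Pb (c : bool) (G : {set {set 'I_n}}) : Prop :=
    if c then exists2 X, B1 X & dense G X else exists2 X, B2 X & dense G X.
  apply: le_trans (gnp_union p01' (B := predT) (P := Pb) _) _; last first.
    by rewrite big_bool.
  move=> G sG pG; have [h|h] := percolates_cover k2 eH2 L2 (erefl C) sG eP pG.
    by exists true.
  by exists false.
move: hp small h1 h2 h3; lra.
Qed.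

End Lower.


(** * The exponent of a well balanced graph *)

(** The inequality is e_S + 1 <= lambda (|S| - 2) cleared of its denominator; the two disjoint edges
    are the [f0] and [f1] that link a chain. *)
Definition well_balanced (k : nat) (EH : {set {set 'I_k}}) : Prop :=
  [/\ (3 <= k)%N, (k <= #|EH|)%N,
      forall S : {set 'I_k}, (3 <= #|S| < k)%N ->
        ((k - 2) * (eIn EH S).+1 <= (#|EH| - 2) * (#|S| - 2))%N
    & exists u0 u1 w0 w1 : 'I_k, [/\ uniq [:: u0; u1; w0; w1],
        [set u0; u1] \in EH & [set w0; w1] \in EH]].

Lemma ell_well_balanced (R : realType) (k : nat) (EH : {set {set 'I_k}}) :
  EH \subset pairs 'I_k -> well_balanced EH -> ell_exists_eq EH (lambda_H R EH)^-1.
Proof.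
move=> EHp [k3 kE bal [u0 [u1 [w0 [w1 [uq f0E f1E]]]]]].
pose a := (#|EH| - 2)%N; pose b := (k - 2)%N.
have b0 : (0 < b)%N by rewrite subn_gt0.
have ba : (b <= a)%N by apply: leq_sub2r.
have k2 : (2 <= k)%N by apply: ltnW.
(* The lower bound also uses sets of size two, where the stronger inequality fails, but a single
   edge costs exactly [b]. *)
have bal2 (S : {set 'I_k}) : (2 <= #|S| < k)%N -> (b * eIn EH S <= a * (#|S| - 2) + b)%N.
  case/andP; rewrite leq_eqVlt => /predU1P[S2 _|S3 Sk].
    rewrite -S2 subnn muln0 add0n -[X in (_ <= X)%N]muln1 leq_mul2l; apply/orP; right.
    rewrite /eIn; apply: (@leq_trans #|[set S]|); last by rewrite cards1.
    apply: subset_leq_card; apply/fintype.subsetP => h; rewrite !inE => /andP[hE hS].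
    have := fintype.subsetP EHp h hE; rewrite inE => /eqP h2.
    by rewrite eqEcard hS h2 -S2.
  apply: (@leq_trans (a * (#|S| - 2))); last exact: leq_addr.
  by apply: leq_trans (bal S _); [rewrite leq_mul2l leqnSn orbT|rewrite S3].
pose kappa : R := b%:R / a%:R.
have -> : (lambda_H R EH)^-1 = kappa.
  by rewrite /lambda_H /kappa invf_div /a /b !natrB // (leq_trans k2).
have kappa0 : 0 < kappa by rewrite divr_gt0 // ltr0n // (leq_trans b0).
apply/cvgrPdist_le => eps eps0.
pose e := Num.min eps (Num.min (kappa / 2) 1).
have e0 : 0 < e by rewrite !lt_min eps0 ltr01 divr_gt0.
have ek : 0 < e < kappa.
  rewrite e0 /=; apply: (@le_lt_trans _ _ (kappa / 2)); first by rewrite !ge_min lexx orbT.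
  by move: kappa0; lra.
have e1 : e <= 1 by rewrite !ge_min lexx !orbT.
have ee : e <= eps by rewrite ge_min lexx.
have [n1 hi] := p_c_upper EHp f0E f1E uq (erefl a) (erefl b) b0 ba bal ek e1.
have [n2 lo] := p_c_lower EHp (erefl a) (erefl b) b0 ba bal2 e0.
exists (n1 + n2 + 2)%N => //= n hn.
have {}hi := hi n (leq_trans (leq_trans (leq_addr _ _) (leq_addr _ _)) hn).
have {}lo := lo n (leq_trans (leq_trans (leq_addl _ _) (leq_addr _ _)) hn).
have nge2 : (1 < n)%N by apply: leq_trans hn; apply: leq_addl.
have y1 : 1 < n%:R :> R by rewrite ltr1n.
have y0 : 0 < n%:R :> R by apply: lt_trans y1.
have ly : 0 < ln (n%:R : R) by apply: ln_gt0.
have pc0 : 0 < p_c R EH n by apply: lt_le_trans lo; apply: powR_gt0.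
have hi' : ln (p_c R EH n) <= (e - kappa) * ln n%:R.
  by rewrite -ln_powR ler_ln ?posrE // powR_gt0.
have lo' : (- (kappa + e)) * ln n%:R <= ln (p_c R EH n).
  by rewrite -ln_powR ler_ln ?posrE // powR_gt0.
apply: le_trans ee; rewrite ler_distlC; apply/andP; split.
  by rewrite ler_pdivlMr //; move: hi'; lra.
by rewrite ler_pdivrMr //; move: lo'; lra.
Qed.


(** * Random graphs are well balanced *)

(** From [expR (- x) >= 1 - x] one gets [expR x <= 1 / (1 - x)], and [(1 - x) * (1 + x + 2 * x ^+ 2)
    = 1 + x ^+ 2 * (1 - 2 * x)]. *)
Lemma expR_le_quad (R : realType) (x : R) : x <= 2^-1 -> expR x <= 1 + x + 2 * x ^+ 2.
Proof.
move=> x2; have h := expR_ge1Dx (- x); rewrite expRN in h.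
have e0 := expR_gt0 x.
have : (1 - x) * expR x <= 1 by rewrite -ler_pdivlMr // mul1r.
have : 1 <= (1 - x) * (1 + x + 2 * x ^+ 2).
  have := sqr_ge0 x; rewrite expr2; nra.
move=> h1 h2; have x1 : 0 < 1 - x by lra.
by rewrite -(ler_pM2l x1); apply: le_trans h1.
Qed.

(** Exponential Markov inequality, with [th] of either sign so that it serves both tails; the term
    linear in [th] cancels against the mean. *)
Lemma gnp_chernoff (R : realType) (T : finType) (p th c : R) (A : {set {set T}}) :
  0 <= p <= 1 -> A \subset pairs T -> th <= 2^-1 ->
  gnp_prob p (fun G => c <= th * (#|G :&: A|%:R - p * #|A|%:R))
    <= expR (2 * th ^+ 2 * #|A|%:R - c).
Proof.
move=> p01 sA th2; have /andP[p0 p1] := p01.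
apply: (@le_trans _ _ (Ex p (pairs T) (fun G =>
    expR (- (th * (p * #|A|%:R)) - c) * expR th ^+ #|G :&: A|))).
  have eq (G : {set {set T}}) : expR (- (th * (p * #|A|%:R)) - c) * expR th ^+ #|G :&: A|
      = expR (th * (#|G :&: A|%:R - p * #|A|%:R) - c).
    rewrite -expRM_natr -expRD; congr expR; ring.
  apply: gnp_markov => // G _.
  by rewrite eq => h; rewrite -[X in X <= _]expR0 ler_expR subr_ge0.
rewrite ExZ Ex_pow //.
have h : 1 + p * (expR th - 1) <= expR (p * th + 2 * th ^+ 2).
  apply: le_trans (expR_ge1Dx _); rewrite lerD2l.
  have := expR_le_quad th2; have := sqr_ge0 th; nra.
have h0 : 0 <= 1 + p * (expR th - 1).
  by have := expR_ge0 th; nra.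
apply: (@le_trans _ _ (expR (- (th * (p * #|A|%:R)) - c) * expR (p * th + 2 * th ^+ 2) ^+ #|A|)).
  by rewrite ler_wpM2l ?expR_ge0 // lerXn2r // nnegrE expR_ge0.
rewrite -expRM_natr -expRD ler_expR le_eqVlt; apply/orP; left; apply/eqP; ring.
Qed.

Section Degrees.
Variables (k : nat) (G : {set {set 'I_k}}).
Hypothesis Gpairs : G \subset pairs 'I_k.

Definition star (v : 'I_k) : {set {set 'I_k}} := [set e in pairs 'I_k | v \in e].
Definition inside (S : {set 'I_k}) : {set {set 'I_k}} := [set e in pairs 'I_k | e \subset S].

Lemma card_star v : #|star v| = k.-1.
Proof.
have -> : star v = (fun w => [set v; w]) @: [set~ v].
  apply/setP => e; apply/idP/imsetP => [|[w wv ->]].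
    rewrite !inE => /andP[/cards2P[x [y [xy ->]]]].
    rewrite !inE => /orP[/eqP ->|/eqP ->]; [exists y|exists x] => //; rewrite ?inE //.
    - by rewrite eq_sym.
    - by rewrite setUC.
  by move: wv; rewrite !inE eqxx cards2 andbT eq_sym => ->.
rewrite card_in_imset; first by rewrite cardsC1 card_ord.
move=> w w'; rewrite !inE => wv w'v /setP/(_ w); rewrite !inE eqxx orbT.
by rewrite (negPf wv) => /esym/eqP.
Qed.

Lemma card_inside S : #|inside S| = 'C(#|S|, 2).
Proof. by rewrite -cards_draws; apply: eq_card => e; rewrite !inE andbC. Qed.

Lemma eIn_inside S : eIn G S = #|G :&: inside S|.
Proof.
apply: eq_card => e; rewrite !inE; case: (boolP (e \in G)) => //= eG.
by have := fintype.subsetP Gpairs e eG; rewrite inE => ->.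
Qed.

Lemma eIn_le S : (eIn G S <= 'C(#|S|, 2))%N.
Proof. by rewrite eIn_inside -card_inside subset_leq_card // subsetIr. Qed.

(** Double counting by edges: an edge inside [T] is seen twice by the degrees, a crossing edge once,
    and an edge missing [T] only by the second term. *)
Lemma sum_degrees (T : {set 'I_k}) :
  (\sum_(v in T) #|G :&: star v| + eIn G (~: T) <= #|G| + eIn G T)%N.
Proof.
have -> : (\sum_(v in T) #|G :&: star v| = \sum_(e in G) #|e :&: T|)%N.
  transitivity (\sum_(v in T) \sum_(e in G) (v \in e))%N.
    apply: eq_bigr => v _; rewrite -big_mkcondr /= sum1dep_card; apply: eq_card => e.
    rewrite !inE; case: (boolP (e \in G)) => //= eG.
    by have := fintype.subsetP Gpairs e eG; rewrite inE => ->.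
  rewrite exchange_big; apply: eq_bigr => e _; rewrite -big_mkcondr /= sum1dep_card.
  by apply: eq_card => v; rewrite !inE andbC.
have eE S : eIn G S = (\sum_(e in G) (e \subset S))%N.
  by rewrite -big_mkcondr /= sum1dep_card.
rewrite !eE -[#|G|]sum1_card -!big_split /=; apply: leq_sum => e eG.
have ce : #|e| = 2%N by have := fintype.subsetP Gpairs e eG; rewrite inE => /eqP.
have le2 : (#|e :&: T| <= 2)%N by rewrite -ce subset_leq_card // subsetIl.
case: (boolP (e \subset ~: T)) => eT.
  have -> : e :&: T = set0 by apply/eqP; rewrite setI_eq0 disjoints_subset.
  by rewrite cards0.
rewrite addn0; case: (boolP (e \subset T)) => [//|neT].
rewrite addn0 leqNgt; apply/negP => h; case/negP: neT.
have /eqP <- : e :&: T == e by rewrite eqEcard subsetIl ce.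
exact: subsetIr.
Qed.

(** A vertex off a first edge has three incident edges, of which at most two lead to the ends of
    that edge. *)
Lemma two_disjoint_edges : (3 <= k)%N -> (forall v, (3 <= #|G :&: star v|)%N) ->
  exists u0 u1 w0 w1 : 'I_k, [/\ uniq [:: u0; u1; w0; w1],
        [set u0; u1] \in G & [set w0; w1] \in G].
Proof.
move=> k3 deg.
have nbr v (B : {set {set 'I_k}}) : (#|B| <= 2)%N ->
    exists w, [/\ v != w, [set v; w] \in G & [set v; w] \notin B].
  move=> B2; have : ~~ (G :&: star v \subset B).
    apply/negP => /subset_leq_card h; have := leq_trans (deg v) (leq_trans h B2).
    by rewrite ltnn.
  case/subsetPn => e; rewrite !inE => /and3P[eG + ve] eB.
  case/cards2P => x [y [xy exy]]; move: ve; rewrite exy !inE => /orP[]/eqP vE.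
    by exists y; rewrite vE -exy.
  by exists x; rewrite vE setUC -exy eq_sym.
have [u0 _] : exists u0 : 'I_k, true by exists (Ordinal (leq_trans (ltn0Sn 2) k3)).
have [|u1 [u01 eu _]] := nbr u0 set0; first by rewrite cards0.
have [w0] : exists w0, w0 \notin [set u0; u1].
  apply/existsP; rewrite -negb_forall; apply: contraTN k3 => /forallP h.
  rewrite -leqNgt -[X in (X <= _)%N]card_ord -cardsT.
  apply: leq_trans (_ : #|[set u0; u1]| <= _)%N; last by rewrite cards2; case: (_ != _).
  by apply: subset_leq_card; apply/fintype.subsetP => x _.
rewrite !inE negb_or => /andP[w00 w01].
have [|w1 [w01' ew]] := nbr w0 [set [set w0; u0]; [set w0; u1]].
  by rewrite cards2; case: (_ != _).
rewrite !inE negb_or => /andP[n0 n1].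
exists u0, u1, w0, w1; split => //; rewrite /= !inE !negb_or u01 w01' !andbT /=.
rewrite [u0 == w0]eq_sym [u1 == w0]eq_sym w00 w01 /=.
by apply/andP; split; [apply: contraNneq n0 => ->|apply: contraNneq n1 => ->].
Qed.

End Degrees.


(** * Balancedness inequalities for small, middle and large vertex sets *)

Section BalanceArithmetic.
(** [a] and [d] stand for alpha and delta, [k] and [e] for the numbers of vertices and edges of H,
    [s] and [E] for those of a vertex subset. *)
Variables (R : realFieldType) (a d k s e E : R).
Hypothesis a0 : 0 < a.
Hypothesis a1 : a <= 1.
Hypothesis dE : d = a ^+ 3 / 64.
Hypothesis ak : 200 <= a ^+ 3 * k.
Hypothesis E0 : 0 <= E.
Hypothesis e_ge : k * (a * (k - 1) - d * k) / 2 <= e.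

Let a2 : 0 <= a * a <= a.
Proof. by rewrite ger_pMl // a1 mulr_ge0 // ltW. Qed.

Let a3 : 0 <= a ^+ 3 <= a.
Proof. by rewrite exprSr expr2; case/andP: a2 => h1 h2; apply/andP; split; [rewrite mulr_ge0 // ltW|rewrite ger_pMl //; move: a1 h2; lra]. Qed.

Let k0 : 0 < k.
Proof. by rewrite ltNge; apply/negP => h; case/andP: a3 => h1 _; move: ak; rewrite leNgt => /negP; apply; apply: le_lt_trans (_ : 0 < 200) => //; apply: mulr_ge0_le0. Qed.

Let ak200 : 200 <= a * k.
Proof. by apply: le_trans ak _; case/andP: a3 => _ h; rewrite ler_wpM2r // ltW. Qed.

Let k200 : 200 <= k.
Proof. by apply: le_trans ak200 _; rewrite ger_pMl. Qed.

Let d0 : 0 <= d <= a / 64.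
Proof. by rewrite dE; case/andP: a3 => h1 h2; apply/andP; split; lra. Qed.

Let dk : 0 <= d * k <= a * k / 64.
Proof. by case/andP: d0 => h1 h2; rewrite mulr_ge0 ?(ltW k0) //= mulrAC ler_wpM2r // ltW. Qed.

(** Even a complete graph on [s <= a * k / 2] vertices has about [a * k / 4] edges per vertex at
    most, half of lambda, which is close to [a * k / 2]. *)
Lemma balanced_small : 3 <= s -> s <= a * k / 2 -> E <= s * (s - 1) / 2 ->
  (k - 2) * (E + 1) <= (e - 2) * (s - 2).
Proof.
move=> s3 sa Es; have /andP[dk0 dk1] := dk.
(* Equality holds for a triangle, [s = 3] and [E = 3]. *)
have h1 : E + 1 <= (s - 2) * ((s + 5) / 2) by move: Es s3; lra.
have h2 : (k - 2) * ((s + 5) / 2) <= e - 2.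
  have h3 : k * (a * k * (31 / 64)) - k / 2 <= e.
    apply: le_trans e_ge; have := ler_wpM2l (ltW k0) dk1.
    have : a * k <= k by rewrite ger_pMl.
    have : 0 <= k * (a * k) by rewrite !mulr_ge0 // ltW.
    lra.
  have h4 : (k - 2) * ((s + 5) / 2) <= k * (a * k / 4 + 5 / 2).
    by have := ler_wpM2l (ltW k0) sa; lra.
  have := ler_wpM2l (ltW k0) ak200; move: h3 h4 k200; lra.
have k2 : 0 <= k - 2 by move: k200; lra.
apply: (@le_trans _ _ ((k - 2) * ((s - 2) * ((s + 5) / 2)))).
  by rewrite ler_wpM2l.
by rewrite mulrCA [X in _ <= X]mulrC ler_wpM2l //; lra.
Qed.

(** [E] is about [a * s ^+ 2 / 2] and [lambda * s] about [a * k * s / 2], so the slack is of order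
    [a * s * (k - s)], which is at least [a ^+ 3 * k ^+ 2 / 8] in this range. The choice
    [d = a ^+ 3 / 64] keeps the error terms below it. *)
Lemma balanced_middle : a * k / 2 <= s -> s <= k - a * k / 4 ->
  E <= a * (s * (s - 1) / 2) + d * k ^+ 2 ->
  (k - 2) * (E + 1) <= (e - 2) * (s - 2).
Proof.
move=> s1 s2 Es; have /andP[dk0 dk1] := dk; have /andP[dd0 dd1] := d0.
pose z := a ^+ 2 * k ^+ 2; pose w := a ^+ 3 * k ^+ 3.
have z200 : 200 * k <= z.
  have h : 200 * k <= a ^+ 3 * k * k by rewrite ler_wpM2r // ltW.
  apply: le_trans h _; rewrite /z.
  have -> : a ^+ 3 * k * k = a * (a ^+ 2 * k ^+ 2) by ring.
  by rewrite ger_pMl // ; apply: mulr_gt0; apply: exprn_gt0.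
have w200 : 200 * k ^+ 2 <= w.
  have -> : w = a ^+ 3 * k * k ^+ 2 by rewrite /w; ring.
  by rewrite ler_wpM2r // exprn_ge0 // ltW.
have zw : a * k * z = w by rewrite /z /w; ring.
have s0 : 0 < s by move: ak200 s1; lra.
have up : (k - 2) * (E + 1) <= k * (a * s * (k - a * k / 4) / 2 + d * k ^+ 2 + 1).
  have h1 : E + 1 <= a * s * (k - a * k / 4) / 2 + d * k ^+ 2 + 1.
    rewrite lerD2r; apply: le_trans Es _; rewrite lerD2r.
    have : s * (s - 1) <= s * (k - a * k / 4) by rewrite ler_wpM2l ?ltW //; lra.
    by move=> h; have := ler_wpM2l (ltW a0) h; rewrite mulrA; lra.
  apply: (@le_trans _ _ (k * (E + 1))); last by rewrite ler_wpM2l // ltW.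
  by rewrite ler_wpM2r //; move: E0; lra.
apply: le_trans up _.
apply: (@le_trans _ _ ((k * (a * (k - 1) - d * k) / 2 - 2) * (s - 2))); last first.
  by rewrite ler_wpM2r //; move: ak200 e_ge; lra.
have dz : d * k ^+ 2 <= z / 64.
  rewrite dE /z.
  have -> : a ^+ 3 / 64 * k ^+ 2 = a * (a ^+ 2 * k ^+ 2 / 64) by field.
  rewrite ger_pMl //; apply: divr_gt0 => //; apply: mulr_gt0; exact: exprn_gt0.
have dw : k * (d * k ^+ 2) = w / 64 by rewrite dE /w; field.
have br : z * (11 / 100) <= z / 8 - d * k ^+ 2 / 2 - a * k / 2 - 2.
  have : a * k <= k by rewrite ger_pMl.
  by move: dz z200 k200; lra.
have z0 : 0 <= z by apply: mulr_ge0; apply: sqr_ge0.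
have sb : w * (11 / 200) <= s * (z / 8 - d * k ^+ 2 / 2 - a * k / 2 - 2).
  apply: (@le_trans _ _ (s * (z * (11 / 100)))); last by rewrite ler_wpM2l // ltW.
  have := ler_wpM2r z0 s1; rewrite -zw; lra.
have kk : k <= k ^+ 2 by rewrite expr2 ler_pMl //; move: k200; lra.
have akk : a * k ^+ 2 <= k ^+ 2 by rewrite ger_pMl // exprn_gt0.
have dkk : 0 <= d * k ^+ 2 by rewrite mulr_ge0 // sqr_ge0.
rewrite -subr_ge0.
have -> : (k * (a * (k - 1) - d * k) / 2 - 2) * (s - 2) -
    k * (a * s * (k - a * k / 4) / 2 + d * k ^+ 2 + 1) =
  s * (z / 8 - d * k ^+ 2 / 2 - a * k / 2 - 2) - a * k ^+ 2 + a * k + d * k ^+ 2 + 4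
    - k * (d * k ^+ 2) - k by rewrite /z; field.
by rewrite dw; move: sb w200 kk akk dkk ak200; lra.
Qed.

(** With [t = k - s] the claim reads [(e - 2) * t <= (k - 2) * (e - E - 3)]: each of the [t] deleted
    vertices removes about [a * k * 55 / 64] edges or more, while lambda is only about
    [a * k / 2]. *)
Lemma balanced_large : 1 <= k - s -> k - s <= a * k / 4 ->
  e <= a * (k * (k - 1) / 2) + d * k ^+ 2 ->
  (k - s) * (a * (k - 1) - d * k) - (k - s) ^+ 2 / 2 <= e - E ->
  (k - 2) * (E + 1) <= (e - 2) * (s - 2).
Proof.
have [t ->] : exists t, s = k - t by exists (k - s); ring.
have -> : k - (k - t) = t by ring.
move=> t1 ta eU eE; have /andP[dk0 dk1] := dk; have /andP[dd0 dd1] := d0.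
(* 55/64 is 1 - 1/64 - 1/8, the losses coming from [d * k] and from half of [t]; the 4 absorbs [a]
   and the constant 3. *)
pose q := a * k * (55 / 64) - 4.
have q0 : 0 <= q by rewrite /q; move: ak200; lra.
have h1 : t * q <= e - E - 3.
  have : t * (a * k * (55 / 64) - 1) <= t * (a * (k - 1) - d * k - t / 2).
    by rewrite ler_wpM2l //; move: t1 ta dk1 a1; lra.
  rewrite /q; move: eE; rewrite expr2; lra.
have h2 : e - 2 <= (k - 2) * q.
  have h3 : d * k ^+ 2 <= a * k / 64 * k.
    by rewrite expr2 mulrA ler_wpM2r // ltW.
  have h4 : 200 * k <= a * k * k by rewrite ler_wpM2r // ltW.
  have h5 : a * (k * (k - 1) / 2) <= a * k * k / 2.
    by have := mulr_gt0 a0 k0; lra.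
  have h6 : a * k <= k by rewrite ger_pMl.
  rewrite /q; move: eU h3 h4 h5 h6 k200.
  lra.
have h3 : (e - 2) * t <= (k - 2) * (e - E - 3).
  apply: (@le_trans _ _ ((k - 2) * q * t)); first by rewrite ler_wpM2r //; lra.
  by rewrite -mulrA ler_wpM2l // 1?mulrC //; move: k200; lra.
by move: h3; lra.
Qed.

End BalanceArithmetic.


Lemma bin2_real (R : realType) (n : nat) : ('C(n, 2))%:R = n%:R * (n%:R - 1) / 2 :> R.
Proof.
case: n => [|n]; first by rewrite mul0r mul0r.
have h : (n.+1%:R * n%:R = 2 * ('C(n.+1, 2))%:R :> R).
  by rewrite -natrM -[2 in RHS]/(2%:R) -natrM -(mul_bin_diag n.+1 1) bin1.
have -> : (n.+1%:R - 1 : R) = n%:R by rewrite -natr1 addrK.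
by rewrite h mulrAC divff ?mul1r // pnatr_eq0.
Qed.

(** * Degree and density control imply balancedness *)

Section Regular.
Variables (R : realType) (alpha delta : R) (k : nat) (G : {set {set 'I_k}}).
Hypothesis Gpairs : G \subset pairs 'I_k.
Hypothesis alpha01 : 0 < alpha <= 1.
Hypothesis deltaE : delta = alpha ^+ 3 / 64.
Hypothesis k_large : 200 <= alpha ^+ 3 * k%:R.
Hypothesis deg : forall v, alpha * (k%:R - 1) - delta * k%:R <= #|G :&: star v|%:R.
Hypothesis dens : forall S : {set 'I_k},
  #|G :&: inside S|%:R <= alpha * ('C(#|S|, 2))%:R + delta * k%:R ^+ 2.

Lemma sum_degrees_real (T : {set 'I_k}) :
  #|T|%:R * (alpha * (k%:R - 1) - delta * k%:R) + (eIn G (~: T))%:R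
    <= #|G|%:R + (eIn G T)%:R :> R.
Proof.
apply: (@le_trans _ _ ((\sum_(v in T) #|G :&: star v| + eIn G (~: T))%N%:R)).
  rewrite natrD lerD2r natr_sum mulr_natl -sumr_const; apply: ler_sum => v _.
  exact: deg.
by rewrite -natrD ler_nat sum_degrees.
Qed.

Lemma regular_well_balanced : well_balanced G.
Proof.
have /andP[a0 a1] := alpha01.
have a31 : alpha ^+ 3 <= 1 by apply: exprn_ile1 => //; apply: ltW.
have a3a : alpha ^+ 3 <= alpha.
  by rewrite exprS ger_pMr // exprn_ile1 // ltW.
have k200 : 200 <= k%:R :> R.
  apply: le_trans k_large _; rewrite ger_pMl //.
  rewrite ltr0n lt0n; apply/negP => /eqP k0; move: k_large; rewrite k0 mulr0; lra.
have ak200 : 200 <= alpha * k%:R by apply: le_trans k_large _; rewrite ler_wpM2r.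
have kN : (200 <= k)%N by rewrite -(ler_nat R).
have dk : delta * k%:R <= alpha * k%:R / 64.
  by rewrite deltaE mulrAC ler_wpM2r // ler_wpM2r.
have GT : eIn G setT = #|G|.
  by apply: eq_card => e; rewrite !inE subsetT andbT.
have e_ge : k%:R * (alpha * (k%:R - 1) - delta * k%:R) / 2 <= #|G|%:R.
  have := sum_degrees_real setT; rewrite cardsT card_ord GT.
  have := ler0n R (eIn G (~: setT)); lra.
have e_le : #|G|%:R <= alpha * (k%:R * (k%:R - 1) / 2) + delta * k%:R ^+ 2.
  by have := dens setT; rewrite -eIn_inside // GT cardsT card_ord bin2_real.
have eS S : (eIn G S)%:R <= (#|S|%:R * (#|S|%:R - 1) / 2 : R).
  by rewrite -bin2_real ler_nat eIn_le.
have kG : (k <= #|G|)%N.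
  rewrite -(ler_nat R); apply: le_trans e_ge.
  have h : 2 <= alpha * (k%:R - 1) - delta * k%:R by move: ak200 a1 dk; lra.
  by rewrite -mulrA ler_peMr // ?ler0n //; move: h; lra.
split => //.
- by apply: leq_trans kN.
- move=> S /andP[S3 Sk].
  rewrite -(ler_nat R) !natrM -natr1 !natrB //; last 3 first.
  + by apply: ltnW.
  + by apply: leq_trans kG; apply: leq_trans kN.
  + by apply: leq_trans kN.
  have S3' : 3 <= #|S|%:R :> R by rewrite -[X in X <= _]/(3%:R) ler_nat.
  have E0 := ler0n R (eIn G S).
  have [sA|sA] := lerP (#|S|%:R) (alpha * k%:R / 2).
    exact: (balanced_small a0 a1 deltaE k_large e_ge S3' sA (eS S)).
  have [sB|sB] := lerP (#|S|%:R) (k%:R - alpha * k%:R / 4).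
    apply: (balanced_middle a0 a1 deltaE k_large E0 e_ge (ltW sA) sB).
    by have := dens S; rewrite -eIn_inside // bin2_real.
  have cC : #|~: S|%:R = k%:R - #|S|%:R :> R.
    by rewrite cardsCs setCK card_ord natrB // ltnW.
  apply: (balanced_large a0 a1 deltaE k_large _ _ e_le).
  + by rewrite -cC -[X in X <= _]/(1%:R) ler_nat -(ltn_add2l #|S|) addn0 cardsC card_ord.
  + by move: sB; lra.
  (* The degree sum counts twice the edges among the [t] deleted vertices, of which there are at
     most [t ^+ 2 / 2]. *)
  + have := sum_degrees_real (~: S); rewrite setCK => h.
    have h2 := eS (~: S); have := ler0n R #|~: S|.
    move: h h2; rewrite cC; move: (#|S|%:R) (eIn G S)%:R (eIn G (~: S))%:R (#|G|%:R) => s x y e.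
    rewrite expr2; lra.
- apply: two_disjoint_edges => //; first by apply: leq_trans kN.
  move=> v; rewrite -(ler_nat R); apply: le_trans (deg v).
  by move: ak200 a1 dk; lra.
Qed.

End Regular.

(** One of [k] degrees deviates by [delta * k], or one of [2 ^ k] edge counts by [delta * k ^+ 2].
    With [th = delta / 4] up to sign, the quadratic term of the Chernoff bound costs at most half of
    [delta ^+ 2 / 4] and leaves [delta ^+ 2 / 8]. *)
Lemma irregular_prob (R : realType) (alpha delta : R) (k : nat) :
  0 < alpha <= 1 -> delta = alpha ^+ 3 / 64 -> 200 <= alpha ^+ 3 * k%:R ->
  gnp_prob alpha (fun G : {set {set 'I_k}} => ~ well_balanced G) <=
    k%:R * expR (- (delta ^+ 2 / 8 * k%:R)) +
    2 ^+ k * expR (- (delta ^+ 2 / 8 * k%:R ^+ 2)).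
Proof.
move=> a01 dE kl; have /andP[a0 a1] := a01.
have a01' : 0 <= alpha <= 1 by rewrite ltW.
have a31 : alpha ^+ 3 <= 1 by apply: exprn_ile1 => //; apply: ltW.
have d0 : 0 < delta by rewrite dE divr_gt0 // exprn_gt0.
have d1 : delta <= 1 by rewrite dE; lra.
have k0 : (0 < k)%N.
  by rewrite lt0n; apply/negP => /eqP k0; move: kl; rewrite k0 mulr0; lra.
pose P1 (v : 'I_k) (G : {set {set 'I_k}}) : Prop :=
  delta ^+ 2 / 4 * k%:R <= - (delta / 4) * (#|G :&: star v|%:R - alpha * #|star v|%:R).
pose P2 (S : {set 'I_k}) (G : {set {set 'I_k}}) : Prop :=
  delta ^+ 2 / 4 * k%:R ^+ 2 <= delta / 4 * (#|G :&: inside S|%:R - alpha * #|inside S|%:R).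
pose Pb (c : bool) (G : {set {set 'I_k}}) : Prop :=
  if c then exists v, P1 v G else exists S, P2 S G.
have cs (v : 'I_k) : #|star v|%:R = k%:R - 1 :> R.
  by rewrite card_star -subn1 natrB.
apply: le_trans (gnp_union a01' (B := predT) (P := Pb) _) _.
  move=> G sG nwb; apply: contrapT => h; apply: nwb.
  apply: (regular_well_balanced sG a01 dE kl) => [v|S].
    rewrite leNgt; apply/negP => hv; apply: h; exists true => //; exists v.
    rewrite /P1 cs; have := ler_wpM2l (ltW d0) (ltW hv); lra.
  rewrite leNgt; apply/negP => hS; apply: h; exists false => //; exists S.
  rewrite /P2 card_inside; have := ler_wpM2l (ltW d0) (ltW hS); lra.
have dd : 0 <= delta ^+ 2 by apply: sqr_ge0.
rewrite big_bool /=; apply: lerD.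
  apply: le_trans (gnp_union a01' (B := predT) (P := P1) _) _.
    by move=> G _ [v hv]; exists v.
  rewrite mulr_natl -[k in _ *+ k]card_ord -sumr_const; apply: ler_sum => v _.
  apply: le_trans (@gnp_chernoff _ _ alpha (- (delta / 4)) (delta ^+ 2 / 4 * k%:R) (star v) a01' _ _) _.
  - by apply/fintype.subsetP => e; rewrite inE => /andP[].
  - by lra.
  rewrite ler_expR cs; lra.
apply: le_trans (gnp_union a01' (B := predT) (P := P2) _) _.
  by move=> G _ [S hS]; exists S.
have -> : 2 ^+ k = #|{: {set 'I_k}}|%:R :> R.
  by rewrite -cardsT -powersetT card_powerset cardsT card_ord natrX.
rewrite mulr_natl -sumr_const; apply: ler_sum => S _.
apply: le_trans (@gnp_chernoff _ _ alpha (delta / 4) (delta ^+ 2 / 4 * k%:R ^+ 2) (inside S) a01' _ _) _.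
- by apply/fintype.subsetP => e; rewrite inE => /andP[].
- by lra.
rewrite ler_expR.
have h : #|inside S|%:R <= k%:R ^+ 2 :> R.
  rewrite card_inside -natrX ler_nat bin2 -divn2 (leq_trans (leq_div _ _)) // -mulnn.
  by apply: leq_mul; [|apply: leq_trans (leq_pred _) _];
    rewrite -[X in (_ <= X)%N]card_ord max_card.
have := ler_wpM2l dd h; lra.
Qed.

(** [expR (q * k)] dominates the square of half its exponent, which beats the factor [k]. In the
    second term, [2 ^+ k <= expR k] and [q * k >= 2] leave [expR (- k)]. *)
Lemma irregular_decay (R : realType) (q : R) (k : nat) : 0 < q -> (0 < k)%N -> 2 <= q * k%:R ->
  k%:R * expR (- (q * k%:R)) + 2 ^+ k * expR (- (q * k%:R ^+ 2)) <= (4 / q ^+ 2 + 1) / k%:R.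
Proof.
move=> q0 k0 qk; have K0 : 0 < k%:R :> R by rewrite ltr0n.
rewrite mulrDl mul1r; apply: lerD.
  rewrite expRN ler_pdivrMr ?expR_gt0 //.
  have h : (q * k%:R / 2) ^+ 2 <= expR (q * k%:R).
    have z0 : 0 <= q * k%:R / 2 by move: qk; lra.
    rewrite -[X in expR X](@divfK _ 2) // expRM_natr lerXn2r ?nnegrE ?expR_ge0 //.
    by apply: le_trans (expR_ge1Dx _); rewrite lerDr.
  apply: (@le_trans _ _ (4 / q ^+ 2 / k%:R * (q * k%:R / 2) ^+ 2)).
    have -> : 4 / q ^+ 2 / k%:R * (q * k%:R / 2) ^+ 2 = k%:R.
      by field; rewrite !lt0r_neq0.
    by [].
  by rewrite ler_wpM2l // !divr_ge0 // ?exprn_ge0 // ltW.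
have e2 : 2 ^+ k <= expR k%:R :> R.
  rewrite -[k%:R]mul1r expRM_natr lerXn2r ?nnegrE ?expR_ge0 //.
  by have := expR_ge1Dx (1 : R); lra.
apply: (@le_trans _ _ (expR k%:R * expR (- (q * k%:R ^+ 2)))).
  by rewrite ler_wpM2r ?expR_ge0.
rewrite -expRD; apply: (@le_trans _ _ (expR (- k%:R))).
  rewrite ler_expR; have := ler_wpM2r (ltW K0) qk; rewrite expr2 mulrA; lra.
rewrite expRN lef_pV2 ?posrE ?expR_gt0 //.
by have := expR_ge1Dx (k%:R : R); lra.
Qed.

(** * Convergence of the probability to one *)

Local Open Scope classical_set_scope.

Theorem theorem1 (R : realType) (alpha : R) (halpha : 0 < alpha <= 1) :
  ((fun k : nat =>
     gnp_prob alpha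
       (fun EH : {set {set 'I_k}} => ell_exists_eq EH (lambda_H R EH)^-1))
   : R^nat) @ \oo --> (1 : R).
Proof.
have /andP[a0 a1] := halpha; have a01 : 0 <= alpha <= 1 by rewrite ltW.
have a30 : 0 < alpha ^+ 3 by apply: exprn_gt0.
pose delta := alpha ^+ 3 / 64; pose q := delta ^+ 2 / 8.
have q0 : 0 < q by rewrite !divr_gt0 ?exprn_gt0 // divr_gt0.
apply/cvgrPdist_le => eps eps0.
(* Thresholds on [k] for [irregular_prob], for [irregular_decay], and for a final error of at most
   [eps], in this order. *)
pose x1 := 200 / alpha ^+ 3; pose x2 := 2 / q; pose x3 := (4 / q ^+ 2 + 1) / eps.
have x10 : 0 <= x1 by rewrite divr_ge0 // ltW.
have x20 : 0 <= x2 by rewrite divr_ge0 // ltW.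
have x30 : 0 <= x3 by rewrite divr_ge0 ?addr_ge0 ?divr_ge0 ?exprn_ge0 // ltW.
exists (Num.bound x1 + Num.bound x2 + Num.bound x3).+1 => //= k hk.
have k0 : (0 < k)%N by apply: leq_ltn_trans hk.
have K0 : 0 < k%:R :> R by rewrite ltr0n.
have hb x m : 0 <= x -> (Num.bound x <= m)%N -> (m <= k)%N -> x <= k%:R :> R.
  move=> /archi_boundP/ltW h hm mk; apply: le_trans h _.
  by rewrite ler_nat (leq_trans hm).
have hk' := ltnW hk.
have k1 : x1 <= k%:R by apply: hb hk' => //; rewrite -addnA leq_addr.
have k2 : x2 <= k%:R by apply: hb hk' => //; rewrite addnAC leq_addl.
have k3 : x3 <= k%:R by apply: hb hk' => //; rewrite leq_addl.
have kl : 200 <= alpha ^+ 3 * k%:R by rewrite mulrC -ler_pdivrMr.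
have qk : 2 <= q * k%:R by rewrite mulrC -ler_pdivrMr.
rewrite ger0_norm ?subr_ge0 ?gnp_le1 // -gnpC.
apply: (@le_trans _ _ (gnp_prob alpha (fun G : {set {set 'I_k}} => ~ well_balanced G))).
  apply: ler_gnp => // G sG nell wb; apply: nell; exact: ell_well_balanced.
apply: le_trans (irregular_prob halpha erefl kl) _.
apply: le_trans (irregular_decay q0 k0 qk) _.
by rewrite ler_pdivrMr // [eps * _]mulrC -ler_pdivrMr.
Qed.
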